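(* Let $G$ be a finitely generated group, let $\mathcal H$ be a separable complex Hilbert space, let $\pi\colon G\to U(\mathcal H)$ be a unitary representation, and let $n\ge 1$. Let $c_1,\dots,c_n\in Z^1(G,\mathrm{HS}(\mathcal H)_{\mathrm{Ad}\,\pi})$ be skew-adjoint, and assume that $H^2(G,\mathrm{HS}(\mathcal H)_{\mathrm{Ad}\,\pi})=0$. Then there exists an $n$-parameter analytic unitary deformation $(\pi_t)_t$ of $\pi$ whose first derivative at $t=0$ is given by $c_1,\dots,c_n$, i.e. $\frac{\partial}{\partial t_i}\pi_t(g)\big|_{t=0}=c_i(g)\pi(g)$ for all $g\in G$ and $1\le i\le n$.
   Context: $\mathrm{HS}(\mathcal H)$ is the ideal of Hilbert–Schmidt operators with norm $\|T\|_2^2=\operatorname{Tr}(T^*T)$. $\mathrm{HS}(\mathcal H)_{\mathrm{Ad}\,\pi}$ denotes $\mathrm{HS}(\mathcal H)$ with the isometric $G$-action $g\cdot T=\pi(g)T\pi(g)^{-1}$. For a $G$-module $V$, $C^k(G,V)=V^{G^k}$ are the inhomogeneous $k$-cochains with the usual differential $d_k$ (so $(d_1c)(g,h)=g\cdot c(h)-c(gh)+c(g)$), $Z^k(G,V)=\ker d_k$, and $H^k(G,V)=Z^k(G,V)/d_{k-1}C^{k-1}(G,V)$ is unreduced cohomology (no closure of coboundaries is taken). A cochain $c\in C^1(G,\mathrm{HS}(\mathcal H)_{\mathrm{Ad}\,\pi})$ is skew-adjoint if $c(g)^*=-c(g)$ for all $g\in G$. An $n$-parameter analytic unitary deformation of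 $\pi$ is a family of unitary representations $\pi_t\colon G\to U(\mathcal H)$, for $t=(t_1,\dots,t_n)$ in an open neighbourhood of $0\in\mathbb R^n$, of the form $\pi_t(g)=u_t(g)\pi(g)$ with $u_t(g)=1_{\mathcal H}+\sum_{|\alpha|\ge1}c_\alpha(g)t^\alpha$, where $\alpha$ runs over multi-indices in $\mathbb N^n$, $c_\alpha(g)\in\mathrm{HS}(\mathcal H)$, and for every $g\in G$ the series converges absolutely in $\|\cdot\|_2$ on that neighbourhood. *)

(* Defs.v *)
(* MathComp-Analysis. Complex scalars are R[i] for an arbitrary R : realType. *)
From HB Require Import structures.
From mathcomp Require Import all_boot all_order all_algebra.
From mathcomp Require Import sesquilinear complex finmap.
From mathcomp Require Import all_classical all_reals all_analysis.
From mathcomp Require Import showcase.summability.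
Set Implicit Arguments.
Unset Strict Implicit.
Unset Printing Implicit Defensive.
Import Order.TTheory GRing.Theory Num.Theory.
Import numFieldNormedType.Exports.
Local Open Scope classical_set_scope.
Local Open Scope ring_scope.
Local Open Scope complex_scope.

Section Groups.
Variable G : groupType.

Definition finitely_generated : Prop :=
  exists s : seq G, forall K : {pred G},
    group_closed K -> {subset s <= K} -> K =i predT.

(* A G-module is presented as a subgroup V of an ambient abelian group M,
   together with an action of G on M preserving V. *)
Variables (M : zmodType) (V : set M) (act : G -> M -> M).

Definition cochain (k : nat) : set (k.-tuple G -> M) :=
  [set c | forall g, V (c g)].

(* For 0-based j, [lift ord0 j] is position j + 1 and [lift ord_max j] is
   position j of a (k+1)-tuple. *)
Definition merge (k : nat) (i : 'I_k) (g : k.+1.-tuple G) : k.-tuple G :=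
  [tuple if (j < i)%N then tnth g (lift ord_max j)
         else if j == i
              then (tnth g (lift ord_max j) * tnth g (lift ord0 j))%g
              else tnth g (lift ord0 j) | j < k].

(* g_1 c(g_2, .., g_{k+1}) + \sum_{i=1}^k (-1)^i c(.., g_i g_{i+1}, ..)
     + (-1)^{k+1} c(g_1, .., g_k) *)
Definition cobound (k : nat) (c : k.-tuple G -> M) (g : k.+1.-tuple G) : M :=
  act (tnth g ord0) (c [tuple tnth g (lift ord0 j) | j < k])
  + \sum_(i < k) c (merge i g) *~ (-1) ^+ i.+1
  + c [tuple tnth g (lift ord_max j) | j < k] *~ (-1) ^+ k.+1.

Definition cocycle (k : nat) : set (k.-tuple G -> M) :=
  [set c | cochain c /\ cobound c = 0].

Definition coboundary (k : nat) : set (k.-tuple G -> M) :=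
  match k with
  | 0 => [set 0]
  | k'.+1 => @cobound k' @` @cochain k'
  end.

(* The quotient of cocycles by coboundaries (no closure) is trivial. *)
Definition cohomology_vanishes (k : nat) : Prop :=
  @cocycle k `<=` @coboundary k.

Lemma cobound1E (c : 1.-tuple G -> M) (g h : G) :
  cobound c [tuple g; h] =
  act g (c [tuple h]) - c [tuple (g * h)%g] + c [tuple g].
Proof.
rewrite /cobound big_ord1 expr1 mulrNz mulr1z sqrrN expr1n mulr1z.
congr (act _ (c _) - c _ + c _); apply: eq_from_tnth => i;
  by rewrite !tnth_mktuple (ord1 i).
Qed.

Lemma cobound2E (c : 2.-tuple G -> M) (g h k : G) :
  cobound c [tuple g; h; k] =
  act g (c [tuple h; k]) - c [tuple (g * h)%g; k] + c [tuple g; (h * k)%g]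
  - c [tuple g; h].
Proof.
rewrite /cobound big_ord_recr big_ord1 /= expr1 mulrNz mulr1z sqrrN expr1n.
rewrite mulr1z exprS sqrrN expr1n mulr1 mulrNz mulr1z !addrA.
congr (act _ (c _) - c _ + c _ - c _); apply: eq_from_tnth => i;
  rewrite !tnth_mktuple; by case: i => -[|[|]].
Qed.

End Groups.

HB.mixin Record isHilbert (R : realType) H
    of CompleteNormedModule R[i] H := {
  hdot : {dot H for Num.conj};
  hdot_norm : forall x : H, hdot x x = `|x| ^+ 2
}.

#[short(type="hilbertType")]
HB.structure Definition Hilbert (R : realType) :=
  {H of CompleteNormedModule R[i] H & isHilbert R H}.

Section Operators.
Variables (R : realType) (H : hilbertType R).
Implicit Types T : H -> H.

Definition separable_space : Prop :=
  exists D : set H, countable D /\ dense D.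

Definition orthonormal_basis (E : set H) : Prop :=
  (forall x y, E x -> E y -> hdot x y = (x == y)%:R) /\
  (forall v : H, (forall e, E e -> hdot v e = 0) -> v = 0).

Definition onb : set H := xget set0 [set E | orthonormal_basis E].

Definition adjoint T : H -> H :=
  xget 0 [set S | forall x y, hdot (T x) y = hdot x (S y)].

(* Trace of a positive operator; its value does not depend on the basis. *)
Definition trace T : \bar R :=
  \esum_(e in onb) (complex.Re (hdot (T e) e))%:E.

(* Only meaningful for bounded operators: [adjoint T] is 0 when T has no
   adjoint. *)
Definition hs_norm T : \bar R := sqrte (trace (adjoint T \o T)).

Definition hilbert_schmidt : set (H -> H) :=
  [set T | [/\ linear T, continuous T & (hs_norm T < +oo)%E]].

Definition unitary T : Prop :=
  [/\ linear T, bijective T & forall x y, hdot (T x) (T y) = hdot x y].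

Definition skew_adjoint T : Prop := adjoint T = - T.

End Operators.

Section Representations.
Variables (R : realType) (H : hilbertType R) (G : groupType).

Definition unitary_rep (pi : G -> H -> H) : Prop :=
  (forall g, unitary (pi g)) /\ (forall g h, pi (g * h)%g = pi g \o pi h).

Definition Ad (pi : G -> H -> H) (g : G) (T : H -> H) : H -> H :=
  pi g \o T \o pi g^-1%g.

End Representations.

Section Deformations.
Variables (R : realType) (H : hilbertType R) (G : groupType) (n : nat).

Definition multidegree (a : {ffun 'I_n -> nat}) : nat := (\sum_i a i)%N.

Definition monomial (t : 'rV[R]_n) (a : {ffun 'I_n -> nat}) : R :=
  \prod_i t ord0 i ^+ a i.

(* u - 1 is the sum in HS(H) of \sum_{|a| >= 1} t^a c_a, with absolute
   convergence: the sums over finite sets of multi-indices converge to u - 1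
   in hs_norm along inclusion. *)
Definition hs_power_series (c : {ffun 'I_n -> nat} -> H -> H) (t : 'rV[R]_n)
    (u : H -> H) : Prop :=
  hilbert_schmidt (u - id) /\
  (\esum_(a in [set a | (1 <= multidegree a)%N])
      (`|monomial t a|%:E * hs_norm (c a)) < +oo)%E /\
  (fun A : {fset {ffun 'I_n -> nat}} =>
     hs_norm (u - id - \sum_(a <- A | (1 <= multidegree a)%N)
                         (monomial t a)%:C *: c a))
    @ totally --> 0%E.

Definition analytic_unitary_deformation (pi : G -> H -> H)
    (U : set 'rV[R]_n) (pit : 'rV[R]_n -> G -> H -> H) : Prop :=
  open U /\ U 0 /\
  (forall t, U t -> unitary_rep (pit t)) /\
  exists (u : 'rV[R]_n -> G -> H -> H) (c : {ffun 'I_n -> nat} -> G -> H -> H),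
    (forall a g, (1 <= multidegree a)%N -> hilbert_schmidt (c a g)) /\
    (forall t g, U t ->
       hs_power_series (c ^~ g) t (u t g) /\ pit t g = u t g \o pi g).

(* D is the partial derivative of f in the i-th variable at 0, as a limit of
   difference quotients in hs_norm. *)
Definition hs_partial_at0 (f : 'rV[R]_n -> H -> H) (i : 'I_n) (D : H -> H) :
    Prop :=
  (fun s : R => hs_norm ((s^-1)%:C *: (f (s *: 'e_i) - f 0) - D))
    @ 0^' --> 0%E.

End Deformations.

(* Main.v *)
(* Formal solution: look for u = 1 + U with U(g) a noncommutative power series
   in n letters, indexed by words, satisfying u(gh) = u(g) (g . u(h)) and
   u(g) u(g)^* = 1.  Word length by word length, the multiplicativity defect is a
   2-cocycle, hence a coboundary since H^2 = 0; once it is removed, the remaining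
   unitarity defect is a self-adjoint 1-cocycle, and subtracting half of it keeps
   multiplicativity.

   Convergence: by Baire's theorem d_1 is open onto the 2-cocycles for pointwise
   convergence, so each coboundary has a primitive whose values on the finite
   generating set s are bounded by C times finitely many values of the cocycle.
   Hence A_k, the sum over s of the norms of U(g) truncated at length k and
   weighted by r^length, satisfies A_(k+1) <= r a + D A_k^2 as long as A_k <= 1,
   and stays bounded when r is small.  Grouping words by content gives the
   coefficients c_alpha. *)
Require Import Defs.
From HB Require Import structures.
From mathcomp Require Import all_boot all_order all_algebra.
From mathcomp Require Import sesquilinear complex finmap.
From mathcomp Require Import all_classical all_reals all_analysis.
From mathcomp Require Import showcase.summability.
From mathcomp Require Import ring lra.
Set Implicit Arguments.
Unset Strict Implicit.
Unset Printing Implicit Defensive.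
Import Order.TTheory GRing.Theory Num.Theory.
Import numFieldNormedType.Exports.
Local Open Scope classical_set_scope.
Local Open Scope ring_scope.

(** * Noncommutative power series over Banach star-algebras *)

(** HS(H) has no unit when H is infinite dimensional, so the algebra is non-unital and 1 + U is
    handled through U alone, with [circ] as product. Scalars are real: taking adjoints is then
    linear and commutes with evaluation at a real point. Words are preferred to multi-indices
    because a product is a sum over the splittings of one word, a plain recursion, and reversal of
    words carries the involution; letters are made to commute only at the end. The obstacle is that
    vanishing cohomology yields primitives without any bound. Cochains on G form a Fréchet space, so
    an open mapping argument controls a primitive only through finitely many pairs of group
    elements, and these may lie outside s. Their norms are brought back to s by writing g as a
    product of L generators or inverses, which bounds 1 + |U(g)| by (1 + A_k)^L; a bound linear in
    A_k follows only while A_k <= 1, hence that condition in the induction. The same estimate gives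
    one radius r for all g, although the bound on the series depends on g. *)

HB.mixin Record isBanachStar (R : realType) V of CompleteNormedModule R V := {
  smul : V -> V -> V;
  sadj : V -> V;
  smulDl : forall a b c : V, smul (a + b) c = smul a c + smul b c;
  smulDr : forall a b c : V, smul a (b + c) = smul a b + smul a c;
  smulA : forall a b c : V, smul a (smul b c) = smul (smul a b) c;
  smulZl : forall (k : R) (a b : V), smul (k *: a) b = k *: smul a b;
  smulZr : forall (k : R) (a b : V), smul a (k *: b) = k *: smul a b;
  ler_norm_smul : forall a b : V, `|smul a b| <= `|a| * `|b|;
  sadjD : forall a b : V, sadj (a + b) = sadj a + sadj b;
  sadjZ : forall (k : R) (a : V), sadj (k *: a) = k *: sadj a;
  sadjM : forall a b : V, sadj (smul a b) = smul (sadj b) (sadj a);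
  sadjK : forall a : V, sadj (sadj a) = a;
  norm_sadj : forall a : V, `|sadj a| = `|a|
}.

#[short(type="banachStarType")]
HB.structure Definition BanachStar (R : realType) :=
  {V of CompleteNormedModule R V & isBanachStar R V}.

Section BanachStarTheory.
Variables (R : realType) (V : banachStarType R).
Implicit Types a b c : V.

Lemma smul0l b : smul 0 b = 0.
Proof. by apply: (@addrI _ (smul 0 b)); rewrite -smulDl !addr0. Qed.

Lemma smul0r a : smul a 0 = 0.
Proof. by apply: (@addrI _ (smul a 0)); rewrite -smulDr !addr0. Qed.

Lemma sadj0 : sadj (0 : V) = 0.
Proof. by apply: (@addrI _ (sadj 0)); rewrite -sadjD !addr0. Qed.

Lemma sadjN a : sadj (- a) = - sadj a.
Proof. by rewrite -scaleN1r sadjZ scaleN1r. Qed.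

Lemma smulNl a b : smul (- a) b = - smul a b.
Proof. by rewrite -scaleN1r smulZl scaleN1r. Qed.

Lemma smulNr a b : smul a (- b) = - smul a b.
Proof. by rewrite -scaleN1r smulZr scaleN1r. Qed.

Lemma smul_suml (I : Type) (r : seq I) (P : pred I) (F : I -> V) b :
  smul (\sum_(i <- r | P i) F i) b = \sum_(i <- r | P i) smul (F i) b.
Proof.
by apply: (big_morph (fun x => smul x b)) => [x y|]; rewrite ?smulDl ?smul0l.
Qed.

Lemma smul_sumr (I : Type) (r : seq I) (P : pred I) (F : I -> V) a :
  smul a (\sum_(i <- r | P i) F i) = \sum_(i <- r | P i) smul a (F i).
Proof.
by apply: (big_morph (smul a)) => [x y|]; rewrite ?smulDr ?smul0r.
Qed.

Lemma sadj_sum (I : Type) (r : seq I) (P : pred I) (F : I -> V) :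
  sadj (\sum_(i <- r | P i) F i) = \sum_(i <- r | P i) sadj (F i).
Proof. by apply: (big_morph sadj) => [x y|]; rewrite ?sadjD ?sadj0. Qed.

End BanachStarTheory.

Record star_action (R : realType) (V : banachStarType R) (G : groupType)
    (act : G -> V -> V) : Prop := StarAction {
  actD : forall g a b, act g (a + b) = act g a + act g b;
  actZ : forall g k a, act g (k *: a) = k *: act g a;
  actM : forall g a b, act g (smul a b) = smul (act g a) (act g b);
  act_sadj : forall g a, act g (sadj a) = sadj (act g a);
  act_norm : forall g a, `|act g a| = `|a|;
  actA : forall g h a, act g (act h a) = act (g * h)%g a;
  act1 : forall a, act 1%g a = a
}.

Section Series.
Variables (R : realType) (V : banachStarType R) (X : finType).

Local Notation series := (seq X -> V).
Implicit Types (a b c : series) (w : seq X).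

(** The Cauchy product: the sum of [smul (a u) (b v)] over all splittings of [w] into [u ++ v]. The
    recursion moves the first letter of [w] into the left argument, so inductions on [w] must
    generalize [a]. *)
Fixpoint conv a b w : V :=
  if w is x :: w' then smul (a [::]) (b w) + conv (fun v => a (x :: v)) b w'
  else smul (a [::]) (b [::]).

(* [(1 + a)(1 + b) - 1] *)
Definition circ a b : series := a + b + conv a b.

(** The letters stand for self-adjoint indeterminates that do not commute; an involution reverses
    their products. *)
Definition sstar a : series := fun w => sadj (a (rev w)).

Definition eqm (k : nat) a b := forall w, (size w <= k)%N -> a w = b w.

Lemma convDl a b c w : conv (a + b) c w = conv a c w + conv b c w.
Proof.
elim: w a b => [|x w IH] a b /=; first by rewrite smulDl.
by rewrite !fctE smulDl addrACA -IH.
Qed.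

Lemma convDr a b c w : conv a (b + c) w = conv a b w + conv a c w.
Proof.
elim: w a => [|x w IH] a /=; first by rewrite smulDr.
by rewrite !fctE smulDr addrACA -IH.
Qed.

Lemma conv_smull (u : V) b c w :
  conv (fun v => smul u (b v)) c w = smul u (conv b c w).
Proof.
elim: w b => [|x w IH] b /=; first by rewrite smulA.
by rewrite smulDr smulA -IH.
Qed.

Lemma convA a b c w : conv a (conv b c) w = conv (conv a b) c w.
Proof.
elim: w a b => [|x w IH] a b /=; first by rewrite smulA.
rewrite smulDr -addrA smulA; congr (_ + _).
rewrite IH -conv_smull.
rewrite -[RHS]/(conv (fun v => smul (a [::]) (b (x :: v))
                         + conv (fun v => a (x :: v)) b v) c w).
by rewrite -convDl.
Qed.

Lemma eqm_conv k a a' b b' : eqm k a a' -> eqm k b b' ->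
  eqm k (conv a b) (conv a' b').
Proof.
move=> ea eb w wk.
have {}eb v : (size v <= size w)%N -> b v = b' v.
  by move=> /leq_trans/(_ wk); exact: eb.
have {ea wk k} : forall v, (size v <= size w)%N -> a v = a' v.
  by move=> v /leq_trans/(_ wk); exact: ea.
elim: w a a' eb => [|x w IH] a a' eb ea /=; first by rewrite ea ?eb.
rewrite ea// eb//; congr (_ + _); apply: IH => v vw; last exact: ea.
by apply: eb; rewrite leqW.
Qed.

Lemma eqm_refl k a : eqm k a a. Proof. by []. Qed.

Lemma eqm_sym k a b : eqm k a b -> eqm k b a.
Proof. by move=> e w wk; rewrite e. Qed.

Lemma eqm_trans k a b c : eqm k a b -> eqm k b c -> eqm k a c.
Proof. by move=> e f w wk; rewrite e ?f. Qed.

Lemma eqm_leq k l a b : (l <= k)%N -> eqm k a b -> eqm l a b.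
Proof. by move=> lk e w wl; apply: e; exact: leq_trans lk. Qed.

Lemma eqmD k a a' b b' : eqm k a a' -> eqm k b b' -> eqm k (a + b) (a' + b').
Proof. by move=> e f w wk; rewrite !fctE e ?f. Qed.

Lemma eqm_circ k a a' b b' : eqm k a a' -> eqm k b b' ->
  eqm k (circ a b) (circ a' b').
Proof. by move=> e f; apply: eqmD; [exact: eqmD|exact: eqm_conv]. Qed.

Lemma conv0l b w : conv 0 b w = 0.
Proof. by apply: (@addrI _ (conv 0 b w)); rewrite -convDl !addr0. Qed.

Lemma conv0r a w : conv a 0 w = 0.
Proof. by apply: (@addrI _ (conv a 0 w)); rewrite -convDr !addr0. Qed.

Lemma convNr a b w : conv a (- b) w = - conv a b w.
Proof. by apply/eqP; rewrite -subr_eq0 opprK -convDr addNr conv0r. Qed.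

(* A series of order > k times a series without constant term has
   order > k + 1. *)
Lemma conv_lowl k a b : eqm k a 0 -> b [::] = 0 -> eqm k.+1 (conv a b) 0.
Proof.
move=> a0 b0 w wk.
have [->|wn0] := eqVneq w [::]; first by rewrite /= b0 smul0r.
have {a0 wk k wn0} : forall v, (size v < size w)%N -> a v = 0.
  by move=> v vw; apply: a0; rewrite -ltnS (leq_trans vw).
elim: w a => [|x w IH] a a0 /=; first by rewrite b0 smul0r.
by rewrite a0// smul0l add0r; apply: IH => v vw; exact: a0.
Qed.

Lemma conv_lowr k a b : eqm k b 0 -> a [::] = 0 -> eqm k.+1 (conv a b) 0.
Proof.
move=> b0 a0 [|x w] wk /=; first by rewrite a0 smul0l.
rewrite a0 smul0l add0r.
have /(_ w) := @eqm_conv k (fun v => a (x :: v)) _ b 0 (eqm_refl _) b0.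
by move=> ->//; rewrite conv0r.
Qed.

Lemma circA a b c : circ a (circ b c) = circ (circ a b) c.
Proof.
apply/funext => w; rewrite /circ !fctE !convDl !convDr convA.
by rewrite !addrA [LHS](ACl (1*2*5*3*6*4*7)).
Qed.

(** First-order calculus of obstructions: the product of a series of order above [k] with one
    without constant term has order above [k + 1], so in degree [k + 1] a perturbation enters [circ]
    additively. *)
Lemma circDl k a b z : eqm k z 0 -> b [::] = 0 ->
  eqm k.+1 (circ (a + z) b) (circ a b + z).
Proof.
move=> z0 b0 w wk; rewrite /circ !fctE convDl (conv_lowl z0 b0 wk) addr0.
by rewrite [LHS](ACl (1*3*4*2)).
Qed.

Lemma circDr k a b z : eqm k z 0 -> a [::] = 0 ->
  eqm k.+1 (circ a (b + z)) (circ a b + z).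
Proof.
move=> z0 a0 w wk; rewrite /circ !fctE convDr (conv_lowr z0 a0 wk) addr0.
by rewrite !addrA [LHS](ACl (1*2*4*3)).
Qed.

Lemma sstarK a : sstar (sstar a) = a.
Proof. by apply/funext => w; rewrite /sstar revK sadjK. Qed.

Lemma sstarD a b : sstar (a + b) = sstar a + sstar b.
Proof. by apply/funext => w; rewrite /sstar !fctE sadjD. Qed.

Lemma eqm_sstar k a b : eqm k a b -> eqm k (sstar a) (sstar b).
Proof. by move=> e w wk; rewrite /sstar e// size_rev. Qed.

Lemma conv_rcons a b w x :
  conv a b (rcons w x) = conv a (fun v => b (rcons v x)) w
                         + smul (a (rcons w x)) (b [::]).
Proof.
by elim: w a => [|y w IH] a //=; rewrite IH addrA.
Qed.

Lemma sstarM a b : sstar (conv a b) = conv (sstar b) (sstar a).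
Proof.
apply/funext => w; rewrite /sstar.
elim/last_ind: w a => [|w x IH] a; first by rewrite /= sadjM.
rewrite rev_rcons /= conv_rcons sadjD sadjM addrC rev_rcons IH.
congr (conv _ _ _ + _); apply/funext => v; by rewrite rev_rcons.
Qed.

Lemma sstar_circ a b : sstar (circ a b) = circ (sstar b) (sstar a).
Proof. by rewrite /circ !sstarD sstarM [sstar a + _]addrC. Qed.

(** Each use of the equation raises the order of [b] by one, because [a] has no constant term. *)
Lemma conv_fix0 a b : a [::] = 0 -> (forall w, b w = - conv a b w) -> b = 0.
Proof.
move=> a0 fixb.
have lowb k : eqm k b 0.
  elim: k => [|k IH] w wk; last by rewrite fixb (conv_lowr IH a0 wk) oppr0.
  by move: wk; rewrite leqn0 size_eq0 => /eqP ->; rewrite fixb /= a0 smul0l oppr0.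
by apply/funext => w; exact: (lowb (size w)).
Qed.

Lemma circ_inj a b c : a [::] = 0 -> circ a b = circ a c -> b = c.
Proof.
move=> a0 e; apply/eqP; rewrite -subr_eq0; apply/eqP.
apply: (conv_fix0 a0) => w.
have : b w + conv a b w = c w + conv a c w.
  by have := congr1 (fun f => f w) e; rewrite /circ !fctE -!addrA => /addrI.
move=> e'; rewrite convDr convNr opprD opprK !fctE.
by rewrite -[b w](addrK (conv a b w)) e' addrAC [_ - c w]addrAC subrr add0r addrC.
Qed.

Fixpoint words (k : nat) : seq (seq X) :=
  if k is k'.+1 then [::] :: [seq x :: w | x <- enum X, w <- words k']
  else [:: [::]].

Lemma mem_words k w : (w \in words k) = (size w <= k)%N.
Proof.
elim: k w => [|k IH] [|x w] //=.
rewrite in_cons /= ltnS -IH; apply/allpairsP/idP => [[[y v] /= []]|ww].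
  by move=> _ vk [_ ->].
by exists (x, w); rewrite mem_enum.
Qed.

Lemma words_uniq k : uniq (words k).
Proof.
elim: k => //= k IH; apply/andP; split; first by apply/allpairsP => -[? []].
by apply: allpairs_uniq => //; [exact: enum_uniq|move=> [? ?] [? ?] _ _ /= [-> ->]].
Qed.

Lemma perm_words k l : (k <= l)%N ->
  perm_eq [seq w <- words l | (size w <= k)%N] (words k).
Proof.
move=> kl; apply: uniq_perm; [exact/filter_uniq/words_uniq|exact: words_uniq|].
move=> w; rewrite mem_filter !mem_words.
by case: leqP => //= wk; exact: leq_trans kl.
Qed.

Lemma perm_words_rev k : perm_eq (map rev (words k)) (words k).
Proof.
apply: uniq_perm; [|exact: words_uniq|].
  by rewrite (map_inj_uniq (can_inj revK)) words_uniq.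
move=> w; rewrite mem_words; apply/mapP/idP => [[v]|wk].
  by rewrite mem_words => vk ->; rewrite size_rev.
by exists (rev w); rewrite ?revK// mem_words size_rev.
Qed.

Lemma big_words (T : nmodType) (f : seq X -> T) k :
  \sum_(w <- words k.+1) f w
  = f [::] + \sum_x \sum_(w <- words k) f (x :: w).
Proof. by rewrite big_cons big_allpairs_dep big_enum. Qed.

Definition trunc k a : series := fun w => if (size w <= k)%N then a w else 0.

Lemma eqm_trunc k a : eqm k (trunc k a) a.
Proof. by move=> w wk; rewrite /trunc wk. Qed.

Lemma big_trunc (T : nmodType) (f : seq X -> V -> T) a k l : (k <= l)%N ->
  (forall w, f w 0 = 0) ->
  \sum_(w <- words l) f w (trunc k a w) = \sum_(w <- words k) f w (a w).
Proof.
move=> kl f0; rewrite -(perm_big _ (perm_words kl)) big_filter [RHS]big_mkcond.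
by apply: eq_bigr => w _; rewrite /trunc; case: ifP.
Qed.

Section Wnorm.
Variable r : R.
Hypothesis r0 : 0 <= r.

(** The weighted l^1 norm, cut off at length [k]. It stays a finite sum: a bound uniform in [k]
    takes the place of membership in the Banach algebra of convergent series. *)
Definition wnorm k a : R := \sum_(w <- words k) r ^+ size w * `|a w|.

Lemma wnorm_ge0 k a : 0 <= wnorm k a.
Proof. by apply: sumr_ge0 => w _; rewrite mulr_ge0// exprn_ge0. Qed.

Lemma wnorm0 a : wnorm 0 a = `|a [::]|.
Proof. by rewrite /wnorm big_seq1 mul1r. Qed.

Lemma wnormS k a :
  wnorm k.+1 a = `|a [::]| + r * \sum_x wnorm k (fun v => a (x :: v)).
Proof.
rewrite /wnorm big_words mul1r mulr_sumr; congr (_ + _).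
apply: eq_bigr => x _; rewrite mulr_sumr; apply: eq_bigr => w _.
by rewrite exprS mulrA.
Qed.

Lemma ler_wnormD k a b : wnorm k (a + b) <= wnorm k a + wnorm k b.
Proof.
rewrite -big_split /=; apply: ler_sum => w _.
by rewrite -mulrDr ler_wpM2l ?exprn_ge0// ler_normD.
Qed.

Lemma wnorm_trunc k l a : (k <= l)%N -> wnorm l (trunc k a) = wnorm k a.
Proof.
move=> kl; rewrite /wnorm.
by rewrite (@big_trunc _ (fun w v => r ^+ size w * `|v|) a k l)// => w;
  rewrite normr0 mulr0.
Qed.

Lemma wnorm_subtrunc k l a : (k <= l)%N ->
  wnorm l (a - trunc k a) = wnorm l a - wnorm k a.
Proof.
move=> kl; rewrite -(wnorm_trunc a kl) /wnorm -sumrB; apply: eq_bigr => w _.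
rewrite -mulrBr !fctE /trunc; case: ifP => _; last by rewrite normr0 !subr0.
by rewrite !subrr normr0.
Qed.

Lemma wnorm_mono k l a : (k <= l)%N -> wnorm k a <= wnorm l a.
Proof. by move=> kl; rewrite -subr_ge0 -wnorm_subtrunc// wnorm_ge0. Qed.

Lemma eq_wnorm k a b : eqm k a b -> wnorm k a = wnorm k b.
Proof.
by move=> e; apply: eq_big_seq => w; rewrite mem_words => wk; rewrite e.
Qed.

Lemma wnorm_sstar k a : wnorm k (sstar a) = wnorm k a.
Proof.
rewrite /wnorm -[RHS](perm_big _ (perm_words_rev k)) big_map.
by apply: eq_bigr => w _; rewrite size_rev norm_sadj.
Qed.

Lemma wnorm_smull k (u : V) a : wnorm k (fun w => smul u (a w)) <= `|u| * wnorm k a.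
Proof.
rewrite mulr_sumr; apply: ler_sum => w _; rewrite mulrCA.
by rewrite ler_wpM2l ?exprn_ge0 ?ler_norm_smul.
Qed.

(** Every splitting of a word of length at most [k] is a pair of such words, and the weight is
    multiplicative; the induction follows the recursion of [conv]. *)
Lemma wnorm_conv k a b : wnorm k (conv a b) <= wnorm k a * wnorm k b.
Proof.
elim: k a => [|k IH] a; first by rewrite !wnorm0 ler_norm_smul.
rewrite wnormS [wnorm k.+1 a]wnormS mulrDl.
apply: (@le_trans _ _ (`|a [::]| * `|b [::]| + r * \sum_x
  (`|a [::]| * wnorm k (fun v => b (x :: v))
   + wnorm k (fun v => a (x :: v)) * wnorm k b))).
  rewrite lerD ?ler_norm_smul// ler_wpM2l//; apply: ler_sum => x _.
  apply: le_trans (ler_wnormD k (fun v => smul (a [::]) (b (x :: v)))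
    (conv (fun v => a (x :: v)) b)) _.
  by rewrite lerD ?wnorm_smull.
rewrite big_split /= mulrDr addrA -mulr_sumr mulrCA -mulrDr -wnormS lerD2l.
rewrite -mulr_suml -mulrA ler_wpM2l// ler_wpM2l ?wnorm_mono//.
by apply: sumr_ge0 => x _; exact: wnorm_ge0.
Qed.

Lemma wnorm_circ k a b :
  1 + wnorm k (circ a b) <= (1 + wnorm k a) * (1 + wnorm k b).
Proof.
have := ler_wnormD k (a + b) (conv a b).
have := ler_wnormD k a b; have := wnorm_conv k a b.
rewrite -/(circ a b); lra.
Qed.

(** Without constant terms, a word of length [k + 1] only splits into strictly shorter pieces. This
    gain of one in the index is what turns the estimate on [U] into a recursion in [k]. *)
Lemma wnorm_conv_low k a b : a [::] = 0 -> b [::] = 0 ->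
  wnorm k.+1 (conv a b) <= wnorm k a * wnorm k b.
Proof.
move=> a0 b0.
rewrite -(wnorm_trunc a (leqnSn k)) -(wnorm_trunc b (leqnSn k)).
rewrite (@eq_wnorm _ _ (conv (trunc k a) (trunc k b))) ?wnorm_conv//.
have low c : eqm k (c - trunc k c) 0.
  by move=> w wk; rewrite !fctE eqm_trunc// subrr.
move=> w wk; rewrite -{1}(subrK (trunc k a) a) convDl.
rewrite (conv_lowl (low a) b0 wk) add0r -{1}(subrK (trunc k b) b) convDr.
by rewrite (conv_lowr (low b) _ wk) ?add0r.
Qed.

End Wnorm.

Section Weval.
Variable t : X -> R.

Definition wmono w : R := \prod_(x <- w) t x.

Definition weval k a : V := \sum_(w <- words k) wmono w *: a w.

Lemma wevalD k a b : weval k (a + b) = weval k a + weval k b.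
Proof. by rewrite -big_split; apply: eq_bigr => w _; exact: scalerDr. Qed.

Lemma weval_trunc k l a : (k <= l)%N -> weval l (trunc k a) = weval k a.
Proof.
move=> kl; rewrite /weval.
by rewrite (@big_trunc _ (fun w v => wmono w *: v) a k l)// => w; rewrite scaler0.
Qed.

Lemma weval_subtrunc k l a : (k <= l)%N ->
  weval l (a - trunc k a) = weval l a - weval k a.
Proof.
move=> kl; apply/eqP; rewrite -subr_eq opprK -(weval_trunc a kl) -wevalD.
by rewrite subrK.
Qed.

Lemma weval_sstar k a : weval k (sstar a) = sadj (weval k a).
Proof.
rewrite /weval sadj_sum -[RHS](perm_big _ (perm_words_rev k)) big_map.
apply: eq_bigr => w _; rewrite sadjZ /sstar; congr (_ *: _).
by apply: perm_big; rewrite perm_sym perm_rev.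
Qed.

Lemma wevalS k a : weval k.+1 a
  = a [::] + \sum_x t x *: weval k (fun v => a (x :: v)).
Proof.
rewrite /weval big_words /wmono big_nil scale1r; congr (_ + _).
apply: eq_bigr => x _; rewrite scaler_sumr; apply: eq_bigr => w _.
by rewrite big_cons scalerA.
Qed.

(** The factors are truncated separately, so their product is a polynomial of degree at most [k + l]
    and evaluation is exactly multiplicative, with no tail to estimate. *)
Lemma weval_conv_trunc k l a b :
  weval (k + l) (conv (trunc k a) (trunc l b)) = smul (weval k a) (weval l b).
Proof.
elim: k a => [|k IH] a.
  rewrite /weval [in RHS]/words big_seq1 /wmono big_nil scale1r.
  rewrite -(@big_trunc _ (fun w v => wmono w *: v) b l l)//; last first.
    by move=> w; rewrite scaler0.
  rewrite smul_sumr; apply: eq_bigr => w _; rewrite smulZr; congr (_ *: _).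
  case: w => [|x w] //=.
  rewrite (_ : (fun v => trunc 0 a (x :: v)) = 0) ?conv0l ?addr0//.
rewrite addSn wevalS [in RHS]wevalS smulDl smul_suml.
rewrite (_ : conv _ _ [::] = smul (a [::]) (b [::]))//.
have trS x : (fun v => trunc k.+1 a (x :: v)) = trunc k (fun v => a (x :: v)).
  by apply/funext => v; rewrite /trunc /= ltnS.
under eq_bigr => x _.
  rewrite (_ : (fun v => conv _ _ _) =
    (fun v => smul (a [::]) (trunc l b (x :: v)))
     + conv (trunc k (fun v => a (x :: v))) (trunc l b)); last first.
    by apply/funext => v; rewrite /= trS.
  rewrite wevalD IH scalerDr -smulZl.
  over.
rewrite big_split /= addrA; congr (_ + _).
rewrite -(@weval_trunc _ (k + l).+1 b) ?leqW ?leq_addl// wevalS smulDr smul_sumr.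
congr (_ + _); apply: eq_bigr => x _; rewrite smulZr /weval smul_sumr.
by congr (_ *: _); apply: eq_bigr => w _; rewrite smulZr.
Qed.

Variable r : R.
Hypothesis tr : forall x, `|t x| <= r.

Lemma ler_wmono w : `|wmono w| <= r ^+ size w.
Proof.
rewrite /wmono; elim: w => [|x w IH]; first by rewrite big_nil normr1.
by rewrite big_cons normrM exprS ler_pM.
Qed.

Lemma ler_weval k a : `|weval k a| <= wnorm r k a.
Proof.
apply: le_trans (ler_norm_sum _ _ _) _; apply: ler_sum => w _.
by rewrite normrZ ler_wpM2r// ler_wmono.
Qed.

End Weval.
End Series.

Arguments words X k : simpl never.

(** * Convergence and evaluation of power series *)

Section Limits.
Variables (R : realType) (V : banachStarType R).

Lemma cvg_dist_le (W : normedModType R) (u : nat -> W) (x : W) (e : R^nat) :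
  (forall k, `|u k - x| <= e k) -> e @ \oo --> 0 -> u @ \oo --> x.
Proof.
move=> ue e0; apply/subr_cvg0/norm_cvg0P.
apply: (@squeeze_cvgr _ _ _ _ (cst 0) e) => //; last exact: cvg_cst.
by near=> k; rewrite normr_ge0 ue.
Unshelve. all: by end_near. Qed.

Lemma cvg_dist0 (W : normedModType R) (u : nat -> W) (x : W) :
  u @ \oo --> x -> `|u k - x| @[k --> \oo] --> 0.
Proof. by move=> ux; apply/norm_cvg0P/subr_cvg0. Qed.

Lemma cvg_smul (u v : nat -> V) (x y : V) : u @ \oo --> x -> v @ \oo --> y ->
  smul (u k) (v k) @[k --> \oo] --> smul x y.
Proof.
move=> ux vy.
apply: (@cvg_dist_le _ _ _ (fun k => `|u k - x| * `|v k| + `|x| * `|v k - y|)).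
  move=> k; rewrite (_ : _ - _ = smul (u k - x) (v k) + smul x (v k - y)).
    apply: le_trans (ler_normD _ _) _.
    by rewrite lerD ?ler_norm_smul.
  by rewrite smulDl smulDr smulNl smulNr addrA subrK.
rewrite -[0](addr0 0) -[X in X + _](mul0r `|y|) -[X in _ + X](mulr0 `|x|).
apply: cvgD; apply: cvgM; [exact: cvg_dist0|exact: cvg_norm|exact: cvg_cst|].
exact: cvg_dist0.
Qed.

Lemma cvg_sadj (u : nat -> V) (x : V) : u @ \oo --> x ->
  sadj (u k) @[k --> \oo] --> sadj x.
Proof.
move=> ux; apply: (@cvg_dist_le _ _ _ (fun k => `|u k - x|)); last exact: cvg_dist0.
by move=> k; rewrite -sadjN -sadjD norm_sadj.
Qed.

(** The comparison sequence [s] will be a sequence of partial norms, or minus a sequence of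
    shrinking radii, so that one criterion serves both series and nested balls. *)
Lemma cvg_increment_le (W : completeNormedModType R) (u : nat -> W) (s : R^nat) :
  (forall k l, (k <= l)%N -> `|u l - u k| <= s l - s k) -> cvgn s -> cvgn u.
Proof.
move=> us cs; apply/cauchy_cvgP/cauchy_ballP => e e0.
move/cauchy_cvgP/cauchy_ballP/(_ e e0) : cs.
rewrite !near_map2; apply: filterS => -[k l] /=; rewrite -!ball_normE /=.
wlog kl : k l / (k <= l)%N.
  move=> H; case/orP: (leq_total k l) => [|lk]; first exact: H.
  by rewrite distrC => skl; rewrite distrC; apply: H.
move=> skl; rewrite distrC; apply: le_lt_trans (us _ _ kl) _.
by apply: le_lt_trans skl; rewrite distrC ler_norm.
Qed.

Lemma lim_increment_le (W : completeNormedModType R) (u : nat -> W) (s : R^nat) k :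
  (forall k l, (k <= l)%N -> `|u l - u k| <= s l - s k) -> cvgn s ->
  `|limn u - u k| <= limn s - s k.
Proof.
move=> us cs; have cu := cvg_increment_le us cs.
have cl : `|u l - u k| @[l --> \oo] --> `|limn u - u k|.
  by apply: cvg_norm; apply: cvgB => //; exact: cvg_cst.
have cr : (s l - s k) @[l --> \oo] --> limn s - s k.
  by apply: cvgB => //; exact: cvg_cst.
rewrite -(cvg_lim _ cl)// -(cvg_lim _ cr)//.
apply: ler_lim; [exact: cvgP cl|exact: cvgP cr|].
by near=> l; apply: us; near: l; exact: nbhs_infty_ge.
Unshelve. all: by end_near. Qed.

Lemma cvg_divX2 (C : R) : C / 2 ^+ k @[k --> \oo] --> 0.
Proof.
under eq_fun do rewrite -exprVn.
have : C * 2^-1 ^+ k @[k --> \oo] --> C * (0 : R).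
  apply: cvgM; first exact: cvg_cst.
  by apply: cvg_expr; rewrite gtr0_norm ?invr_gt0// invf_lt1// ltr1n.
by rewrite mulr0.
Qed.

Variables (X : finType) (t : X -> R) (r : R).
Hypothesis tr : forall x, `|t x| <= r.
Hypothesis r0 : 0 <= r.
Implicit Types a b : seq X -> V.

Lemma wnorm_cvg a M : (forall k, wnorm r k a <= M) -> cvgn (fun k => wnorm r k a).
Proof.
move=> aM; apply: nondecreasing_is_cvgn.
  by move=> k l kl; exact: wnorm_mono.
by exists M => _ [k _ <-].
Qed.

Lemma weval_increment a k l : (k <= l)%N ->
  `|weval t l a - weval t k a| <= wnorm r l a - wnorm r k a.
Proof.
by move=> kl; rewrite -weval_subtrunc// -wnorm_subtrunc// ler_weval.
Qed.

Lemma weval_cvg a M : (forall k, wnorm r k a <= M) -> cvgn (fun k => weval t k a).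
Proof.
move=> /wnorm_cvg; apply: cvg_increment_le; exact: weval_increment.
Qed.

Lemma weval_tail a M k : (forall k, wnorm r k a <= M) ->
  `|limn (fun k => weval t k a) - weval t k a|
  <= limn (fun k => wnorm r k a) - wnorm r k a.
Proof.
move=> aM; apply: (lim_increment_le _ _ (wnorm_cvg aM)).
exact: weval_increment.
Qed.

Lemma weval_conv a b M N : (forall k, wnorm r k a <= M) ->
    (forall k, wnorm r k b <= N) ->
  limn (fun k => weval t k (conv a b)) =
  smul (limn (fun k => weval t k a)) (limn (fun k => weval t k b)).
Proof.
move=> aM bN.
have ca := weval_cvg aM; have cb := weval_cvg bN.
have wca := wnorm_cvg aM; have wcb := wnorm_cvg bN.
have abMN k : wnorm r k (conv a b) <= M * N.
  by apply: le_trans (wnorm_conv r0 k a b) _; rewrite ler_pM ?wnorm_ge0.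
have cab := weval_cvg abMN.
have cvgab : weval t (k + k)%N (conv a b) @[k --> \oo] -->
    limn (fun k => weval t k (conv a b)).
  apply: (cvg_comp (fun k : nat => k + k)%N (fun k => weval t k (conv a b)) _ cab).
  apply/cvgnyPge => A; near=> k; rewrite (leq_trans _ (leq_addr _ _))//.
  by near: k; exact: nbhs_infty_ge.
suff cvgab' : weval t (k + k)%N (conv a b) @[k --> \oo] -->
    smul (limn (fun k => weval t k a)) (limn (fun k => weval t k b)).
  exact: (cvg_unique _ cvgab cvgab').
(* At length [2k] the product series differs from the product of the truncations at [k] only by
   splittings with a factor longer than [k]. The norm carried by such factors is [d], which tends to
   0. *)
pose d (c : seq X -> V) k := wnorm r (k + k)%N c - wnorm r k c.
have d0 (c : seq X -> V) L : (forall k, wnorm r k c <= L) -> d c k @[k --> \oo] --> 0.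
  move=> cL; have wc := wnorm_cvg cL.
  rewrite -(subrr (limn (fun k => wnorm r k c))); apply: cvgB => //.
  apply: (cvg_comp (fun k : nat => k + k)%N (fun k => wnorm r k c) _ wc).
  apply/cvgnyPge => A; near=> k; rewrite (leq_trans _ (leq_addr _ _))//.
  by near: k; exact: nbhs_infty_ge.
have step k : `|weval t (k + k)%N (conv a b)
    - smul (weval t k a) (weval t k b)| <= d a k * N + M * d b k.
  rewrite -weval_conv_trunc.
  have -> : weval t (k + k)%N (conv a b)
      - weval t (k + k)%N (conv (trunc k a) (trunc k b)) =
      weval t (k + k)%N (conv (a - trunc k a) b + conv (trunc k a) (b - trunc k b)).
    apply/eqP; rewrite subr_eq -wevalD; apply/eqP; congr weval.
    apply/funext => w; rewrite !fctE -addrA -convDr subrK.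
    by rewrite -convDl subrK.
  apply: le_trans (ler_weval tr _ _) _.
  apply: le_trans (ler_wnormD _ _ _ _) _ => //; rewrite lerD//.
    apply: le_trans (wnorm_conv _ _ _ _) _ => //.
    by rewrite wnorm_subtrunc ?leq_addr// ler_wpM2l// subr_ge0 wnorm_mono ?leq_addr.
  apply: le_trans (wnorm_conv _ _ _ _) _ => //.
  rewrite wnorm_trunc ?wnorm_subtrunc ?leq_addr//.
  by rewrite ler_wpM2r// subr_ge0 wnorm_mono ?leq_addr.
have := cvg_smul ca cb => cs.
rewrite -[X in _ --> X]addr0.
rewrite -(_ : (fun k => smul (weval t k a) (weval t k b)
  + (weval t (k + k)%N (conv a b) - smul (weval t k a) (weval t k b))) =
  (fun k => weval t (k + k)%N (conv a b))); last first.
  by apply/funext => k; rewrite addrC subrK.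
apply: cvgD => //.
apply: (@cvg_dist_le _ _ _ (fun k => d a k * N + M * d b k)).
  by move=> k; rewrite subr0.
rewrite -[0](addr0 0) -[X in X + _](mul0r N) -[X in _ + X](mulr0 M).
by apply: cvgD; apply: cvgM; (try exact: cvg_cst); apply: d0; eassumption.
Unshelve. all: by end_near. Qed.

End Limits.

(** * The open mapping theorem for pointwise limits of bounded lifts *)

Section OpenMapping.
(* Y is a closed space of functions on the countable set I = \bigcup_m E m, and
   [A r] the image in Y of the ball of radius r. *)
Variables (R : realType) (V : completeNormedModType R) (I : eqType).
Variables (E : nat -> seq I) (Y : set (I -> V)) (A : R -> set (I -> V)).
Hypothesis E_mono : forall m, {subset E m <= E m.+1}.
Hypothesis E_cover : forall i, exists m, i \in E m.
Hypothesis Y0 : Y 0.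
Hypothesis Y_add : forall y z, Y y -> Y z -> Y (y + z).
Hypothesis Y_scale : forall (k : R) y, Y y -> Y (k *: y).
Hypothesis Y_closed : forall (u : nat -> I -> V) y,
  (forall j, Y (u j)) -> (forall i, u j i @[j --> \oo] --> y i) -> Y y.
Hypothesis A_sub : forall r, A r `<=` Y.
Hypothesis A_cover : forall y, Y y -> exists r, A r y.
Hypothesis A_mono : forall r s, r <= s -> A r `<=` A s.
Hypothesis A_add : forall r s y z, A r y -> A s z -> A (r + s) (y + z).
Hypothesis A_scale : forall r k y, A r y -> A (`|k| * r) (k *: y).
Hypothesis A_series : forall r (a : nat -> I -> V) y,
  (forall j, A (r / 2 ^+ j) (a j)) ->
  (forall i, (\sum_(j < k) a j i) @[k --> \oo] --> y i) -> A (2 * r) y.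

Definition close_on m e (y z : I -> V) := forall i, i \in E m -> `|y i - z i| <= e.

Lemma E_le m k : (m <= k)%N -> {subset E m <= E k}.
Proof.
by move=> mk; rewrite -(subnKC mk); elim: (k - m)%N => [|l IH] i;
  rewrite ?addn0// addnS => /IH /E_mono.
Qed.

Lemma close_on_le m m' e e' y z : (m' <= m)%N -> e <= e' ->
  close_on m e y z -> close_on m' e' y z.
Proof. by move=> mm ee h i /(E_le mm)/h/le_trans; apply. Qed.

(* Baire's theorem for Y with the topology of pointwise convergence, applied
   to the closures of the sets [A k]. *)
Lemma somewhere_dense : exists (k : nat) (y : I -> V) (m : nat) (e : R),
  [/\ Y y, 0 < e & forall z, Y z -> close_on m e y z ->
    forall m' e', 0 < e' -> exists2 a, A k%:R a & close_on m' e' z a].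
Proof.
apply: contrapT => nodense.
(* One stage of the Baire construction: inside a basic neighbourhood, given by a centre, a finite
   set and a radius, find one of at most half the radius that misses [A k]. *)
have next (k : nat) (s : (I -> V) * nat * R) : exists s' : (I -> V) * nat * R,
    Y s.1.1 -> 0 < s.2 ->
    [/\ Y s'.1.1, 0 < s'.2 <= s.2 / 2, (s.1.2 < s'.1.2)%N,
        close_on s.1.2 (s.2 / 2) s.1.1 s'.1.1
      & forall a, A k%:R a -> ~ close_on s'.1.2 s'.2 s'.1.1 a].
  case: s => -[y m] e /=.
  have [Yy|nYy] := pselect (Y y); last by exists (y, m, e).
  have [e0|ne0] := boolP (0 < e); last by exists (y, m, e).
  apply: contrapT => noext; apply: nodense; exists k, y, m, (e / 2).
  split=> //; first by rewrite divr_gt0.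
  move=> z Yz cyz m' e' e'0; apply: contrapT => nA; apply: noext.
  exists (z, maxn m' m.+1, Num.min e' (e / 2)) => _ _ /=; split=> //.
  - by rewrite lt_min e'0 divr_gt0//= ge_min lexx orbT.
  - by rewrite leq_max leqnn orbT.
  - move=> a Aa ca; apply: nA; exists a => //; apply: close_on_le ca.
      by rewrite leq_maxl.
    by rewrite ge_min lexx.
have [f fP] := choice (fun ks : nat * ((I -> V) * nat * R) => next ks.1 ks.2).
pose st := fix st k := if k is k'.+1 then f (k', st k') else (0, 0%N, 1).
have inv k : Y (st k).1.1 /\ 0 < (st k).2.
  elim: k => [|k [Yk ek]] /=; first by rewrite ltr01.
  by have [? /andP[? _] _ _ _] := fP (k, st k) Yk ek.
have {}fP k := fP (k, st k) (inv k).1 (inv k).2.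
pose y k := (st k).1.1; pose m k := (st k).1.2; pose e k := (st k).2.
have m_mono : {homo m : k l / (k <= l)%N}.
  apply: homo_leq => // [?? ?|k]; first exact: leq_trans.
  by have [_ _ /ltnW] := fP k.
have m_ge k : (k <= m k)%N.
  elim: k => // k IH; have [_ _ mk _ _] := fP k; exact: leq_ltn_trans mk.
(* Each move is at most [e l / 2], and [e (l + 1) <= e l / 2], so it is at most [e l - e (l + 1)]:
   the sequence [- e] dominates the increments. *)
have y_incr k l i : i \in E (m k) -> (k <= l)%N ->
    `|y l i - y k i| <= - e l - - e k.
  move=> ik; elim: l => [|l IH]; first by rewrite leqn0 => /eqP->; rewrite !subrr normr0.
  rewrite leq_eqVlt => /predU1P[->|kl]; first by rewrite !subrr normr0.
  have {IH} := IH kl; have [_ /andP[_ el] _ cl _] := fP l.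
  have {cl} := cl _ (E_le (m_mono k l kl) ik).
  move: el; rewrite -/(e l) -/(e l.+1) -/(y l) -/(y l.+1) => el cl IH.
  rewrite -(subrKA (y l i)) addrC; apply: le_trans (ler_normD _ _) _.
  rewrite (distrC (y l.+1 i)); lra.
have ecvg k0 : cvgn (fun k => - e (k + k0)%N).
  apply: nondecreasing_is_cvgn; last first.
    by exists 0 => _ [k _ <-]; rewrite oppr_le0 ltW//; exact: (inv _).2.
  apply/nondecreasing_seqP => k; rewrite lerN2 addSn.
  have [_ /andP[_ el] _ _ _] := fP (k + k0)%N.
  apply: le_trans el _; rewrite ler_pdivrMr// ler_peMr//; last by rewrite ler1n.
  exact/ltW/(inv _).2.
have ycvg i k0 : i \in E (m k0) ->
    cvgn (fun k => y (k + k0)%N i) /\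
    `|limn (fun k => y (k + k0)%N i) - y k0 i| <= e k0.
  move=> ik.
  have incr k l : (k <= l)%N ->
      `|y (l + k0)%N i - y (k + k0)%N i| <= - e (l + k0)%N - - e (k + k0)%N.
    move=> kl; apply: y_incr; last by rewrite leq_add2r.
    by apply: E_le ik; rewrite m_mono// leq_addl.
  split; first exact: cvg_increment_le incr (ecvg k0).
  apply: le_trans (lim_increment_le 0 incr (ecvg k0)) _.
  rewrite add0n opprK gerDr; apply: limr_le; first exact: ecvg.
  by near=> k; rewrite oppr_le0 ltW//; exact: (inv _).2.
pose z i := limn (fun k => y k i).
have yz i : y k i @[k --> \oo] --> z i.
  have [k ik] := E_cover i.
  have [/cvg_ex[l]+ _] := ycvg i k (E_le (m_ge k) ik).
  by rewrite (cvg_shiftn k (fun k => y k i)) => /cvgP.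
have zlim i k : limn (fun l => y (l + k)%N i) = z i.
  by apply/cvg_lim => //; rewrite (cvg_shiftn k (fun k => y k i)).
have Yz : Y z by apply: (Y_closed (u := y)) => // k; exact: (inv k).1.
(* The limit [z] lies in [A k] for some integer [k], yet stage [k] chose a neighbourhood that
   contains [z] and misses [A k]. *)
have [r Ar] := A_cover Yz.
pose k := Num.bound `|r|.
have Ak : A k%:R z.
  apply: A_mono Ar; apply: le_trans (ler_norm r) _; exact/ltW/archi_boundP/normr_ge0.
have [_ _ _ _ /(_ z Ak)] := fP k; apply=> i ik.
by rewrite distrC -(zlim i k.+1); have [_] := ycvg i k.+1 ik.
Unshelve. all: by end_near. Qed.

(** Differences of approximations move the dense neighbourhood to the origin; successive
    approximation with halved errors then replaces approximate lifts by exact ones. The outer factor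
    2 in the constant sums the radii [C * d / 2 ^+ j]. *)
Lemma open_mapping : exists (m : nat) (C : R), 0 <= C /\
  forall y d, Y y -> 0 < d -> close_on m d y 0 -> A (C * d) y.
Proof.
have [k [y0 [m [e [Yy0 e0 dense0]]]]] := somewhere_dense.
(* Both [y0] and [y0 + (e / d) *: y] are approximated by elements of [A k]. The difference of the
   two approximants, rescaled by [d / e], approximates [y]; hence the constant [2 * k / e]. *)
have dense y m' d : Y y -> 0 < d -> close_on m d y 0 -> forall e', 0 < e' ->
    exists2 a, A (2 * k%:R / e * d) a & close_on m' e' y a.
  move=> Yy d0 yd e' e'0; pose s := e / d.
  have s0 : 0 < s by rewrite divr_gt0.
  have close_y0 z : close_on m d z 0 -> close_on m e y0 (y0 + s *: z).
    move=> zd i im; have := zd i im; rewrite !fctE opprD addNKr subr0 normrN normrZ.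
    rewrite gtr0_norm// => zi.
    by rewrite -[e](divfK (lt0r_neq0 d0)) ler_wpM2l// ltW.
  have se' : 0 < s * e' / 2 by apply: divr_gt0 => //; exact: mulr_gt0.
  have [a Aa ca] := dense0 _ (Y_add Yy0 (Y_scale s Yy)) (close_y0 _ yd) m' _ se'.
  have c0 : close_on m e y0 y0 by move=> i _; rewrite subrr normr0 ltW.
  have [b Ab cb] := dense0 _ Yy0 c0 m' _ se'.
  exists (s^-1 *: (a + (-1) *: b)).
    apply: (A_mono _ (A_scale s^-1 (A_add Aa (A_scale (-1) Ab)))).
    by rewrite gtr0_norm ?invr_gt0// normrN1 mul1r /s invf_div; lra.
  move=> i im; have := ca i im; have := cb i im; rewrite !fctE.
  rewrite scaleN1r => h g.
  have -> : y i - s^-1 *: (a i - b i) =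
      s^-1 *: ((y0 i + s *: y i - a i) - (y0 i - b i)).
    rewrite -[y i in LHS](scalerK (lt0r_neq0 s0)) -scalerBr; congr (_ *: _).
    by rewrite !opprB -[y0 i + _ - _]addrA [y0 i + _]addrC addrACA subrr addr0
      -addrA [- a i + _]addrC.
  rewrite normrZ gtr0_norm ?invr_gt0// ler_pdivrMl//.
  apply: le_trans (ler_normB _ _) _; lra.
pose C := 2 * k%:R / e; have C0 : 0 <= C by rewrite divr_ge0// ltW.
exists m, (2 * C); split=> [|y d Yy d0 yd]; first by rewrite mulr_ge0.
have dj j : 0 < d / 2 ^+ j by rewrite divr_gt0// exprn_gt0.
have next (js : nat * (I -> V)) : exists a, Y js.2 ->
    close_on (m + js.1) (d / 2 ^+ js.1) js.2 0 ->
    A (C * (d / 2 ^+ js.1)) a /\ close_on (m + js.1).+1 (d / 2 ^+ js.1.+1) js.2 a.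
  case: js => j z /=; have [Yz|nYz] := pselect (Y z); last by exists 0.
  have [cz|ncz] := pselect (close_on (m + j) (d / 2 ^+ j) z 0); last by exists 0.
  have [a Aa ca] := dense z (m + j).+1 _ Yz (dj j)
    (close_on_le (leq_addr _ _) (lexx _) cz) _ (dj j.+1).
  by exists a.
have [f fP] := choice next.
(* The remainder [z j] is small on [E (m + j)], a set that grows with [j], so the remainders tend to
   0 at every point and not merely on [E m]. *)
pose z := fix z j := if j is j'.+1 then z j' - f (j', z j') else y.
have inv j : Y (z j) /\ close_on (m + j) (d / 2 ^+ j) (z j) 0.
  elim: j => [|j [Yz cz]] /=; first by rewrite addn0 divr1.
  have [/A_sub Yf cf] := fP (j, z j) Yz cz; split.
    by rewrite -scaleN1r; apply: Y_add => //; exact: Y_scale.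
  by move=> i; rewrite addnS => im; rewrite subr0; exact: cf.
rewrite -mulrA; apply: (@A_series _ (fun j => f (j, z j))).
  by move=> j; rewrite -mulrA; have [Yz cz] := inv j; have [] := fP (j, z j) Yz cz.
move=> i.
have -> : (fun k => \sum_(j < k) f (nat_of_ord j, z j) i) = (fun k => y i - z k i).
  apply/funext; elim=> [|l IH]; first by rewrite big_ord0 subrr.
  rewrite big_ord_recr /= IH -[(_ - f (l, z l)) i]/(z l i - f (l, z l) i).
  by rewrite opprB addrA addrAC -addrA.
rewrite -[X in _ --> X]subr0; apply: cvgB; first exact: cvg_cst.
have [n0 in0] := E_cover i.
rewrite -(cvg_shiftn n0); apply: (@cvg_dist_le _ _ _ _ (fun j => d / 2 ^+ (j + n0))).
  move=> j; have [_ /(_ i)] := inv (j + n0)%N; apply.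
  by apply: E_le in0; rewrite addnA leq_addl.
by rewrite (cvg_shiftn n0 (fun j => d / 2 ^+ j)); exact: cvg_divX2.
Qed.

End OpenMapping.

(** * Cochains on a finitely generated group *)

Section Cochains.
Variables (R : realType) (V : banachStarType R) (G : groupType).
Variable act : G -> V -> V.
Hypothesis hact : star_action act.
Implicit Types (g h k : G) (b : G -> V) (z : G * G -> V).

Lemma act0 g : act g 0 = 0.
Proof. by apply: (@addrI _ (act g 0)); rewrite -(actD hact) !addr0. Qed.

Lemma actN g a : act g (- a) = - act g a.
Proof. by rewrite -scaleN1r (actZ hact) scaleN1r. Qed.

Lemma actK g a : act g^-1%g (act g a) = a.
Proof. by rewrite (actA hact) mulVg (act1 hact). Qed.

Lemma act_sum (I : Type) (r : seq I) (P : pred I) (F : I -> V) g :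
  act g (\sum_(i <- r | P i) F i) = \sum_(i <- r | P i) act g (F i).
Proof. by apply: (big_morph (act g)) => [x y|]; rewrite ?(actD hact) ?act0. Qed.

Lemma cvg_act g (u : nat -> V) (x : V) : u @ \oo --> x ->
  act g (u k) @[k --> \oo] --> act g x.
Proof.
move=> ux; apply: (@cvg_dist_le _ _ _ _ (fun j => `|u j - x|)); last exact: cvg_dist0.
by move=> k; rewrite -actN -(actD hact) (act_norm hact).
Qed.

Definition d1 b : G * G -> V :=
  fun gh => act gh.1 (b gh.2) - b (gh.1 * gh.2)%g + b gh.1.

Definition cocycle2 z := forall g h k,
  act g (z (h, k)) - z ((g * h)%g, k) + z (g, (h * k)%g) - z (g, h) = 0.

Lemma d1D b b' : d1 (b + b') = d1 b + d1 b'.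
Proof.
apply/funext => -[g h]; rewrite /d1 !fctE /= (actD hact) opprD.
by rewrite !addrA [LHS](ACl (1*3*5*2*4*6))/=.
Qed.

Lemma d1Z (x : R) b : d1 (x *: b) = x *: d1 b.
Proof.
apply/funext => -[g h]; rewrite /d1 !fctE /= (actZ hact).
by rewrite scalerDr scalerBr.
Qed.

Lemma d1_sum n (F : 'I_n -> G -> V) : d1 (\sum_(j < n) F j) = \sum_(j < n) d1 (F j).
Proof.
apply: (big_morph d1 d1D); apply/funext => -[g h].
by rewrite /d1 /= act0 subr0 addr0.
Qed.

Lemma d1_cocycle b : cocycle2 (d1 b).
Proof.
move=> g h k; rewrite /d1 /= !(actD hact) !actN !(actA hact) !mulgA.
rewrite !opprD !opprK !addrA [LHS](ACl (1*4*7*2*3*10*5*8*11*6*9*12))/=.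
by rewrite subrr add0r !addrK subrr.
Qed.

Variable s : seq G.
Hypothesis hs : forall K : {pred G},
  group_closed K -> {subset s <= K} -> K =i predT.

Lemma gen_ind (P : G -> Prop) : (forall g, g \in s -> P g) -> P 1%g ->
  (forall g h, P g -> P h -> P (g * h)%g) -> (forall g, P g -> P g^-1%g) ->
  forall g, P g.
Proof.
move=> Ps P1 PM PV g.
suff /(_ g) : [pred g | `[< P g >]] =i predT by rewrite !inE => /asboolP.
apply: hs => [|h hin]; last first.
  by rewrite inE; exact: Ps.
split=> [|h k]; rewrite !inE // => Ph Pk.
by apply: PM => //; exact: PV.
Qed.

(** The values of [b j] at 1, at products and at inverses are determined by [d1 (b j)] and by its
    values at the factors, so convergence spreads from the generators to all of [G]. *)
Lemma cochain_limit (b : nat -> G -> V) z :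
  (forall g, g \in s -> cvgn (fun j => b j g)) ->
  (forall i, d1 (b j) i @[j --> \oo] --> z i) ->
  exists c, [/\ d1 c = z & forall g, b j g @[j --> \oo] --> c g].
Proof.
move=> bs bz; have bcvg g : cvgn (fun j => b j g).
  elim/gen_ind: g => [||g h /cvg_ex[/= x gx] /cvg_ex[/= y hy]|g /cvg_ex[/= x gx]].
  - exact: bs.
  - apply/cvg_ex; exists (z (1%g, 1%g)).
    rewrite (_ : (fun j => b j 1%g) = (fun j => d1 (b j) (1%g, 1%g)))//.
    by apply/funext => j; rewrite /d1 /= (act1 hact) mulg1 subrr add0r.
  - apply/cvg_ex; exists (act g y + x - z (g, h)).
    rewrite (_ : (fun j => b j (g * h)%g) =
      (fun j => act g (b j h) + b j g - d1 (b j) (g, h))).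
      by apply: cvgB => //; apply: cvgD => //; exact: cvg_act.
    by apply/funext => j; rewrite /d1 /= !opprD opprK !addrA
      [RHS](ACl (4*1*3*2*5))/= addrK addrK.
  - apply/cvg_ex; exists (act g^-1%g (z (g, g^-1%g) + z (1%g, 1%g) - x)).
    rewrite (_ : (fun j => b j g^-1%g) = (fun j => act g^-1%g
      (d1 (b j) (g, g^-1%g) + d1 (b j) (1%g, 1%g) - b j g))).
      by apply: cvg_act; apply: cvgB => //; exact: cvgD.
    apply/funext => j; rewrite /d1 /= (act1 hact) !mulgV mulg1 subrr add0r.
    by rewrite [X in act _ X](_ : _ = act g (b j g^-1%g)) ?actK// addrAC addrK subrK.
exists (fun g => limn (fun j => b j g)); split=> [|g]; last exact: bcvg.
apply/funext => -[g h].
suff dc : d1 (b j) (g, h) @[j --> \oo] --> d1 (fun g => limn (fun j => b j g)) (g, h).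
  exact: (cvg_unique _ dc (bz (g, h))).
apply: cvgD; last exact: bcvg.
by apply: cvgB; [apply: cvg_act|]; exact: bcvg.
Qed.

(** Finite sets that exhaust [G]; they provide the countable exhaustion on which the Baire argument
    for functions on [G * G] rests. *)
Fixpoint gen_ball m : seq G :=
  if m is m'.+1 then gen_ball m' ++ [seq (g * h)%g | g <- gen_ball m', h <- gen_ball m']
    ++ map (fun g => g^-1)%g (gen_ball m')
  else 1%g :: s.

Lemma gen_ball_le (m k : nat) : (m <= k)%N -> {subset gen_ball m <= gen_ball k}.
Proof.
move=> mk; rewrite -(subnKC mk); elim: (k - m)%N => [|l IH] i.
  by rewrite addn0.
by rewrite addnS /= mem_cat => /IH ->.
Qed.

Lemma gen_ball_cover g : exists m, g \in gen_ball m.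
Proof.
elim/gen_ind: g => [g gs||g h [m gm] [k hk]|g [m gm]].
- by exists 0%N; rewrite in_cons gs orbT.
- by exists 0%N; rewrite mem_head.
- exists (maxn m k).+1; rewrite /= !mem_cat; apply/orP; right; apply/orP; left.
  by apply/allpairsP; exists (g, h); split=> //=;
    [apply: gen_ball_le gm; rewrite leq_maxl|apply: gen_ball_le hk; rewrite leq_maxr].
- by exists m.+1; rewrite /= !mem_cat map_f ?orbT.
Qed.

Hypothesis H2 : forall z, cocycle2 z -> exists b, d1 b = z.

Lemma lift_bound : exists (E : seq (G * G)) (C : R), 0 <= C /\
  forall z, cocycle2 z -> exists b, d1 b = z /\
    forall g, g \in s -> `|b g| <= C * \sum_(i <- E) `|z i|.
Proof.
pose E m := [seq (g, h) | g <- gen_ball m, h <- gen_ball m].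
(* Bounding primitives on [s] alone is compatible with infinite sums: [cochain_limit] recovers a
   primitive on all of [G] from convergence on [s]. *)
pose A r z := exists b, d1 b = z /\ forall g, g \in s -> `|b g| <= r.
have [||||||||||||m [C [C0 open_d1]]] := @open_mapping R V _ E cocycle2 A.
- move=> m i /allpairsP[[g h] [/= gm hm ->]].
  by apply/allpairsP; exists (g, h); split=> //=; exact: gen_ball_le (leqnSn _) _ _.
- move=> [g h]; have [m gm] := gen_ball_cover g; have [k hk] := gen_ball_cover h.
  exists (maxn m k); apply/allpairsP; exists (g, h); split=> //=.
    by apply: gen_ball_le gm; rewrite leq_maxl.
  by apply: gen_ball_le hk; rewrite leq_maxr.
- by move=> g h k; rewrite act0 !subr0 addr0.
- move=> y z cy cz g h k; rewrite !fctE (actD hact) !opprD.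
  by rewrite !addrA [LHS](ACl (1*3*5*7*2*4*6*8))/= cy add0r cz.
- move=> c y cy g h k; rewrite !fctE (actZ hact) -!scalerBr -scalerDr -scalerBr.
  by rewrite cy scaler0.
- move=> u y cu uy g h k.
  have : (act g (u j (h, k)) - u j ((g * h)%g, k) + u j (g, (h * k)%g) - u j (g, h))
     @[j --> \oo] --> act g (y (h, k)) - y ((g * h)%g, k) + y (g, (h * k)%g) - y (g, h).
    by apply: cvgB => //; apply: cvgD => //; apply: cvgB => //; exact: cvg_act.
  under eq_fun => j do rewrite cu.
  by move=> h0; rewrite -(cvg_lim _ h0)//; apply/cvg_lim => //; exact: cvg_cst.
- by move=> r z [b [<- _]]; exact: d1_cocycle.
- move=> z /H2[b <-]; exists (\sum_(g <- s) `|b g|), b; split=> // g gs.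
  by rewrite (big_rem g)//= lerDl sumr_ge0.
- by move=> r r' rr' z [b [dz bs]]; exists b; split=> // g /bs/le_trans; apply.
- move=> r r' z z' [b [dz bs]] [b' [dz' bs']]; exists (b + b').
  rewrite d1D dz dz'; split=> // g gs; apply: le_trans (ler_normD _ _) _.
  by rewrite lerD ?bs ?bs'.
- move=> r k z [b [dz bs]]; exists (k *: b); rewrite d1Z dz; split=> // g gs.
  by rewrite normrZ ler_wpM2l ?bs.
- move=> r a y Aa ay.
  have [b bP] := choice Aa.
  pose c (k : nat) : G -> V := \sum_(j < k) b j.
  (* Minus the geometric tail of the bounds [r / 2 ^+ j] for [j >= k]; its increments dominate those
     of [c] on [s]. *)
  pose S (k : nat) : R := - (2 * r / 2 ^+ k).
  have S_cvg : S j @[j --> \oo] --> 0.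
    by rewrite -[X in _ --> X]oppr0; apply: cvgN; exact: cvg_divX2.
  have c_incr g : g \in s -> forall k l : nat, (k <= l)%N -> `|c l g - c k g| <= S l - S k.
    move=> gs k; elim=> [|l IH]; first by rewrite leqn0 => /eqP->; rewrite !subrr normr0.
    rewrite leq_eqVlt => /predU1P[->|kl]; first by rewrite !subrr normr0.
    have := IH kl; have := (bP l).2 g gs.
    have -> : c l.+1 g = c l g + b l g by rewrite /c big_ord_recr.
    have -> : S l.+1 = S l + r / 2 ^+ l.
      by rewrite /S exprS; field; rewrite expf_neq0.
    move=> bl cl; rewrite addrAC; apply: le_trans (ler_normD _ _) _; lra.
  have [g gs|i|b0 [db0 b0P]] := @cochain_limit c y.
  + exact: cvg_increment_le (c_incr g gs) (cvgP _ S_cvg).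
  + rewrite (_ : (fun k : nat => _) = (fun k : nat => \sum_(j < k) a j i))//.
    apply/funext => k; rewrite /c d1_sum fct_sumE; apply: eq_bigr => j _.
    by rewrite (bP j).1.
  + exists b0; split=> // g gs; rewrite -(cvg_lim _ (b0P g))//.
    have := lim_increment_le 0 (c_incr g gs) (cvgP _ S_cvg).
    rewrite (cvg_lim _ S_cvg)// /c big_ord0 subr0 /S expr0 divr1; lra.
exists (E m), C; split=> // z cz; pose d := \sum_(i <- E m) `|z i|.
have zd : forall i, i \in E m -> `|z i| <= d.
  by move=> i im; rewrite /d (big_rem i)//= lerDl sumr_ge0.
have : 0 <= d by exact: sumr_ge0.
rewrite le_eqVlt => /predU1P[d0|d0]; last first.
  by apply: open_d1 => // i im; rewrite subr0 zd.
(* The case where [z] vanishes on [E m]. Any positive [d] is then admissible, so there are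
   primitives bounded by [C / 2 ^+ j] on [s] for every [j]; their limit is a primitive that vanishes
   on [s]. *)
have e_gt0 j : 0 < (2 ^+ j)^-1 :> R by rewrite invr_gt0 exprn_gt0.
have /choice[b bP] : forall j : nat, exists b, d1 b = z /\
    forall g, g \in s -> `|b g| <= C / 2 ^+ j.
  move=> j; apply: open_d1 => // i im.
  by rewrite subr0; apply: le_trans (zd i im) _; rewrite -d0 ltW.
have bs g : g \in s -> b j g @[j --> \oo] --> 0.
  move=> gs; apply: (@cvg_dist_le _ _ _ _ (fun j => C / 2 ^+ j)).
    by move=> j; rewrite subr0; exact: (bP j).2.
  exact: cvg_divX2.
have [g gs|i|c [dc cP]] := @cochain_limit b z.
- exact: cvgP (bs g gs).
- under eq_fun => j do rewrite (bP j).1.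
  exact: cvg_cst.
- exists c; split=> // g gs; rewrite -/d -d0 mulr0.
  by rewrite -(cvg_lim _ (cP g))// (cvg_lim _ (bs g gs))// normr0.
Qed.

End Cochains.

(** * The formal deformation *)

Section Perturbation.
Variables (R : realType) (V : banachStarType R) (X : finType).
Implicit Types a b c d : seq X -> V.

Lemma eqm0_nil k a : eqm k a 0 -> a [::] = 0.
Proof. by move=> ->. Qed.

Lemma eqm_conv_low k a a' b b' : a [::] = 0 -> b [::] = 0 ->
  eqm k a a' -> eqm k b b' -> eqm k.+1 (conv a b) (conv a' b').
Proof.
move=> a0 b0 ea eb w wk.
have ea' : eqm k (a - a') 0 by move=> v vk; rewrite !fctE ea// subrr.
have eb' : eqm k (b - b') 0 by move=> v vk; rewrite !fctE eb// subrr.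
have a'0 : a' [::] = 0 by rewrite -ea.
rewrite -[a in LHS](subrK a') convDl (conv_lowl ea' b0 wk) add0r.
by rewrite -[b in LHS](subrK b') convDr (conv_lowr eb' a'0 wk) add0r.
Qed.

Lemma circD_low k a b c d : eqm k c 0 -> eqm k d 0 -> a [::] = 0 -> b [::] = 0 ->
  eqm k.+1 (circ (a + c) (b + d)) (circ a b + c + d).
Proof.
move=> c0 d0 a0 b0; apply: (eqm_trans (b := circ a (b + d) + c)).
  by apply: circDl; rewrite // fctE b0 (eqm0_nil d0) addr0.
by rewrite [X in eqm _ _ X]addrAC; exact: (eqmD (circDr b d0 a0) (eqm_refl _)).
Qed.

Lemma circ0 a : circ a 0 = a.
Proof. by apply/funext => w; rewrite /circ !fctE conv0r !addr0. Qed.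

Definition homog k (f : seq X -> V) : seq X -> V :=
  fun w => if size w == k then f w else 0.

Lemma homog_low k f : eqm k (homog k.+1 f) 0.
Proof. by move=> w wk; rewrite /homog ltn_eqF. Qed.

End Perturbation.

Section Deformation.
Variables (R : realType) (V : banachStarType R) (G : groupType).
Variable act : G -> V -> V.
Hypothesis hact : star_action act.
Variable X : finType.
Implicit Types (g h : G) (a b : seq X -> V) (U : G -> seq X -> V).

Definition sact g a : seq X -> V := fun w => act g (a w).

Lemma sactD g a b : sact g (a + b) = sact g a + sact g b.
Proof. by apply/funext => w; rewrite /sact (actD hact). Qed.

Lemma sact_conv g a b w : sact g (conv a b) w = conv (sact g a) (sact g b) w.
Proof.
rewrite /sact; elim: w a => [|x w IH] a /=; first exact: (actM hact).
by rewrite (actD hact) IH (actM hact).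
Qed.

Lemma sact_circ g a b : sact g (circ a b) = circ (sact g a) (sact g b).
Proof.
by apply/funext => w; rewrite /circ !sactD !fctE sact_conv.
Qed.

Lemma sact_sstar g a : sact g (sstar a) = sstar (sact g a).
Proof. by apply/funext => w; exact: (act_sadj hact). Qed.

Lemma sactA g h a : sact g (sact h a) = sact (g * h)%g a.
Proof. by apply/funext => w; exact: (actA hact). Qed.

Lemma sact_nil g a : a [::] = 0 -> sact g a [::] = 0.
Proof. by move=> a0; rewrite /sact a0 (act0 hact). Qed.

Lemma eqm_sact k g a b : eqm k a b -> eqm k (sact g a) (sact g b).
Proof. by move=> e w wk; rewrite /sact e. Qed.

Definition mult_upto k U := forall g h, eqm k (U (g * h)%g) (circ (U g) (sact g (U h))).

Definition unit_upto k U := forall g, eqm k (circ (U g) (sstar (U g))) 0.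

Definition mult_defect U (gh : G * G) : seq X -> V :=
  circ (U gh.1) (sact gh.1 (U gh.2)) - U (gh.1 * gh.2)%g.

Lemma mult_defect_low k U gh : mult_upto k U -> eqm k (mult_defect U gh) 0.
Proof. by move=> mU w wk; rewrite /mult_defect !fctE mU// subrr. Qed.

(* Associativity of [circ] makes the first obstruction a 2-cocycle. *)
Lemma mult_defect_cocycle k U w : (forall g, U g [::] = 0) -> mult_upto k U ->
  (size w <= k.+1)%N -> cocycle2 act (fun gh => mult_defect U gh w).
Proof.
move=> U0 mU wk g h l; pose P := mult_defect U.
have defP g' h' : circ (U g') (sact g' (U h')) = U (g' * h')%g + P (g', h').
  by rewrite addrC subrK.
have P_low gh : eqm k (P gh) 0 by exact: mult_defect_low.
rewrite -/P; clearbody P.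
have left : circ (circ (U g) (sact g (U h))) (sact (g * h)%g (U l)) w =
    U (g * h * l)%g w + P ((g * h)%g, l) w + P (g, h) w.
  rewrite defP (circDl _ (P_low _) _ wk) ?sact_nil//.
  by rewrite !fctE [circ _ _](defP (g * h)%g l).
have right : circ (U g) (sact g (circ (U h) (sact h (U l)))) w =
    U (g * h * l)%g w + P (g, (h * l)%g) w + act g (P (h, l) w).
  rewrite defP sactD (circDr _ _ _ wk)//; last first.
    by move=> v vk; rewrite /sact P_low// (act0 hact).
  by rewrite fctE [circ _ _](defP g (h * l)%g) mulgA.
move: left; rewrite -circA -(sactA g h) -sact_circ right -!addrA => /addrI e.
by rewrite addrCA [act g _ + _]addrA [act g _ + _]addrC e addrK addNr.
Qed.

(** Adding terms in degree [k + 1] leaves lower degrees alone and changes the defect in that degree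
    by the group coboundary of the added coefficients. *)
Lemma mult_upto_perturb k U (W : seq X -> G -> V) : (forall g, U g [::] = 0) ->
  mult_upto k U ->
  (forall w, size w = k.+1 -> forall g h,
     act g (W w h) - W w (g * h)%g + W w g = - mult_defect U (g, h) w) ->
  mult_upto k.+1 (fun g => U g + homog k.+1 (W^~ g)).
Proof.
move=> U0 mU dW g h w wk; rewrite sactD.
have low l : eqm k (sact g (homog k.+1 (W^~ l))) 0.
  by move=> v vk; rewrite /sact homog_low// (act0 hact).
rewrite (circD_low (homog_low _) (low _) _ _ wk) ?sact_nil//.
rewrite !fctE /sact {1 2 3}/homog; have [wk1|wk1] := eqVneq (size w) k.+1.
  have := dW w wk1 g h; rewrite /mult_defect !fctE opprB.
  move=> e; apply/eqP; rewrite eq_sym -addrA [W w g + _]addrC.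
  rewrite -subr_eq0 opprD addrACA -[circ _ _ _ - _]opprB -e.
  by rewrite [act g _ + _ - _]addrAC addNr.
by rewrite (act0 hact) !addr0 mU// -ltnS ltn_neqAle wk1.
Qed.

(** Expanding at [g * h] sandwiches the translate by [g] of the defect at [h] between [1 + U g] and
    its star. That defect has order above [k], so in degree [k + 1] the outer factors act on it as
    the identity and the defects add up. *)
Lemma unit_defect_cocycle k U w g h : (forall g, U g [::] = 0) ->
  mult_upto k.+1 U -> unit_upto k U -> (size w <= k.+1)%N ->
  circ (U (g * h)%g) (sstar (U (g * h)%g)) w =
  circ (U g) (sstar (U g)) w + act g (circ (U h) (sstar (U h)) w).
Proof.
move=> U0 mU uU wk; pose H l := circ (U l) (sstar (U l)).
have sU0 l : sstar (U l) [::] = 0 by rewrite /sstar /= U0 sadj0.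
rewrite (eqm_circ (mU g h) (eqm_sstar (mU g h)) wk) sstar_circ.
rewrite circA -(circA (U g)) -sact_sstar -sact_circ -/(H h).
have Hlow : eqm k (sact g (H h)) 0.
  by move=> v vk; rewrite /sact /H uU// (act0 hact).
have e : eqm k.+1 (circ (U g) (sact g (H h))) (U g + sact g (H h)).
  by have := circDr 0 Hlow (U0 g); rewrite circ0 add0r.
by rewrite (eqm_circ e (eqm_refl _) wk) (circDl _ Hlow (sU0 g) wk).
Qed.

Variables (s : seq G) (E : seq (G * G)) (C : R).
Hypothesis lift : forall z, cocycle2 act z -> exists b : G -> V, d1 act b = z /\
  forall g, g \in s -> `|b g| <= C * \sum_(i <- E) `|z i|.

Definition defect_norm U w : R := \sum_(i <- E) `|mult_defect U i w|.

Definition conv_norm U w : R :=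
  \sum_(i <- E) `|conv (U i.1) (sact i.1 (U i.2)) w|.

(* For words of length at least 2 this bounds U by convolutions, which only
   involve strictly shorter words. *)
Definition bound_upto k U := forall w g, g \in s -> (1 < size w <= k)%N ->
  `|U g w| <= C * (conv_norm U w + conv_norm U (rev w))
              + `|conv (U g) (sstar (U g)) w|.

Variable c1 : X -> G -> V.
Hypothesis c1_cocycle : forall x g h, c1 x (g * h)%g = c1 x g + act g (c1 x h).
Hypothesis c1_skew : forall x g, sadj (c1 x g) = - c1 x g.

Definition deforms U :=
  (forall g, U g [::] = 0) /\ (forall g x, U g [:: x] = c1 x g).

Lemma deformation_step k U : (0 < k)%N -> deforms U ->
  mult_upto k U -> unit_upto k U -> bound_upto k U ->
  exists U', [/\ deforms U', mult_upto k.+1 U', unit_upto k.+1 U',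
    bound_upto k.+1 U' & forall g, eqm k (U' g) (U g)].
Proof.
(* Nothing is known about [U] beyond length [k]. With those coefficients set to 0, the defect in
   degree [k + 1] is a pure convolution of shorter coefficients, as the estimate requires. *)
move=> k0 [U0 U1] mU uU bU; pose T g := trunc k (U g).
have TU g : eqm k (T g) (U g) := @eqm_trunc _ _ _ k (U g).
have T0 g : T g [::] = 0 by rewrite TU.
have mT : mult_upto k T.
  move=> g h; apply: (eqm_trans (TU _)); apply: (eqm_trans (mU g h)).
  by apply: eqm_circ; [|apply: eqm_sact]; exact/eqm_sym.
have uT : unit_upto k T.
  by move=> g; apply: (eqm_trans (eqm_circ (TU g) (eqm_sstar (TU g)))).
have /choice[b bP] : forall w, exists b : G -> V, size w = k.+1 ->
    d1 act b = (fun i => mult_defect T i w) /\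
    forall g, g \in s -> `|b g| <= C * defect_norm T w.
  move=> w; have [wk|wk] := eqVneq (size w) k.+1; last first.
    by exists 0 => wk'; rewrite wk' eqxx in wk.
  have [|b bP] := @lift (fun i => mult_defect T i w); last by exists b.
  by apply: mult_defect_cocycle mT _ => //; rewrite wk.
(* S is multiplicative up to order k + 1; F also repairs its unitarity defect H. *)
pose S g := T g + homog k.+1 (fun w => - b w g).
have ST g : eqm k (S g) (T g).
  by move=> w wk; rewrite /S fctE homog_low// addr0.
have S0 g : S g [::] = 0 by rewrite ST.
have mS : mult_upto k.+1 S.
  apply: (mult_upto_perturb (W := fun w g => - b w g)) => // w wk g h.
  have [/(congr1 (fun f => f (g, h))) <- _] := bP w wk.
  by rewrite /d1 /= (actN hact) !opprD opprK.
have uS : unit_upto k S.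
  by move=> g; apply: (eqm_trans (eqm_circ (ST g) (eqm_sstar (ST g)))).
pose H g := circ (S g) (sstar (S g)).
(* [H g] is fixed by [sstar], so subtracting half of it from [S g], and with it from the star of
   [S g], removes exactly [H g] in degree [k + 1]. *)
have H_rev g w : sadj (H g (rev w)) = H g w.
  by have := congr1 (fun f => f w) (sstar_circ (S g) (sstar (S g))); rewrite sstarK.
pose F g := S g + homog k.+1 (fun w => - (2^-1 *: H g w)).
have FS g : eqm k (F g) (S g).
  by move=> w wk; rewrite /F fctE homog_low// addr0.
have FT g : eqm k (F g) (T g) := eqm_trans (FS g) (ST g).
have FU g : eqm k (F g) (U g) := eqm_trans (FT g) (TU g).
have F0 g : F g [::] = 0 by rewrite FU.
have sS0 g : sstar (S g) [::] = 0 by rewrite /sstar /= S0 sadj0.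
have sT0 g : sstar (T g) [::] = 0 by rewrite /sstar /= T0 sadj0.
have cnF w : (size w <= k)%N -> conv_norm F w = conv_norm U w.
  move=> wk; apply: eq_bigr => i _; congr (`|_|).
  exact: (eqm_conv (FU _) (eqm_sact _ (FU _))).
exists F; split=> //.
- by split=> // g x; rewrite FU.
- apply: (mult_upto_perturb (W := fun w g => - (2^-1 *: H g w))) => //.
    by move=> g h; apply: eqm_leq (mS g h).
  move=> w wk g h; rewrite /mult_defect !fctE /= mS ?wk// subrr oppr0.
  rewrite /H (unit_defect_cocycle _ _ S0 mS uS) ?wk//.
  rewrite (actN hact) (actZ hact) scalerDr opprK addrAC.
  by rewrite -opprD (addrC (2^-1 *: act _ _)) addNr.
- move=> g w wk; rewrite /F sstarD.
  have low : eqm k (sstar (homog k.+1 (fun w => - (2^-1 *: H g w)))) 0.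
    by move=> v vk; rewrite /sstar homog_low ?size_rev// sadj0.
  rewrite (circD_low (homog_low _) low (S0 g) (sS0 g) wk) !fctE /sstar /homog.
  rewrite size_rev; have [wk1|wk1] := eqVneq (size w) k.+1.
    rewrite sadjN sadjZ H_rev -/(H g) -addrA -opprD -scalerDl.
    by rewrite (_ : 2^-1 + 2^-1 = 1) ?scale1r ?subrr//; lra.
  by rewrite sadj0 !addr0 uS// -ltnS ltn_neqAle wk1.
- move=> w g gs /andP[w1]; rewrite leq_eqVlt => /predU1P[wk|wk]; last first.
    have -> : conv (F g) (sstar (F g)) w = conv (U g) (sstar (U g)) w.
      by apply: (eqm_conv (FU g) (eqm_sstar (FU g))); rewrite -ltnS.
    by rewrite FU// cnF// cnF ?size_rev// bU// w1 -ltnS.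
  have Tw g' v : size v = k.+1 -> T g' v = 0 by rewrite /T /trunc => ->; rewrite ltnn.
  have Sw g' v : size v = k.+1 -> S g' v = - b v g'.
    by move=> vk; rewrite /S fctE Tw// add0r /homog vk eqxx.
  (* The linear terms of the defect of [T] vanish at length [k + 1]. What remains is a product of
     series without constant term, which sees lengths at most [k] only, where [T] and [F] agree. *)
  have TF v : size v = k.+1 -> defect_norm T v = conv_norm F v.
    move=> vk; apply: eq_bigr => i _; rewrite /mult_defect /circ !fctE /sact.
    rewrite !Tw// (act0 hact) !add0r subr0; congr (`|_|).
    have /(_ v) -> // := @eqm_conv_low _ _ _ k (T i.1) (F i.1)
      (sact i.1 (T i.2)) (sact i.1 (F i.2)) (T0 _) (sact_nil _ (T0 _))
      (eqm_sym (FT _)) (eqm_sact _ (eqm_sym (FT _))).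
    by rewrite vk.
  (* In degree [k + 1] the coefficient of [S] is [- b]. Subtracting half of [H] leaves the part of
     [- b] that is skew for [sstar], minus half of a convolution; the bound is read off from this
     formula. *)
  have -> : F g w = 2^-1 *: (sadj (b (rev w) g) - b w g
      - conv (F g) (sstar (F g)) w).
    have SF : conv (S g) (sstar (S g)) w = conv (F g) (sstar (F g)) w.
      by apply: (@eqm_conv_low _ _ _ k); rewrite ?wk//;
        [exact/eqm_sym|exact/eqm_sstar/eqm_sym].
    have Hw : H g w = - b w g - sadj (b (rev w) g) + conv (F g) (sstar (F g)) w.
      rewrite -[H g w]/(S g w + sadj (S g (rev w)) + conv (S g) (sstar (S g)) w).
      by rewrite SF !Sw ?size_rev// sadjN.
    have -> : F g w = - b w g - 2^-1 *: H g w.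
      by rewrite /F fctE Sw// /homog wk eqxx.
    have half : - b w g = 2^-1 *: (- b w g - b w g).
      by rewrite scalerDr -scalerDl (_ : 2^-1 + 2^-1 = 1) ?scale1r//; lra.
    rewrite [X in X - _]half -scalerBr Hw !opprD !opprK !addrA subrK.
    by rewrite [_ + sadj _]addrC.
  have bw := (bP w wk).2 g gs.
  have brw := (bP (rev w) _).2 g gs; rewrite size_rev in brw.
  have {}brw := brw wk; rewrite !TF ?size_rev// in bw brw.
  rewrite normrZ gtr0_norm ?invr_gt0//.
  have := ler_normB (sadj (b (rev w) g) - b w g) (conv (F g) (sstar (F g)) w).
  have := ler_normB (sadj (b (rev w) g)) (b w g).
  rewrite norm_sadj mulrDr; have := normr_ge0 (b w g).
  have := normr_ge0 (b (rev w) g).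
  have := normr_ge0 (conv (F g) (sstar (F g)) w); lra.
Qed.

(** In degree one, multiplicativity is the 1-cocycle identity and unitarity is skew-adjointness; the
    bound concerns words of length at least 2 and is vacuous here. *)
Lemma deformation_base :
  let U g w := if w is [:: x] then c1 x g else 0 in
  [/\ deforms U, mult_upto 1 U, unit_upto 1 U & bound_upto 1 U].
Proof.
move=> U; split=> [|g h|g|w g _]; first by split.
- case=> [|x [|//]] _; rewrite /circ !fctE /= /sact /=.
    by rewrite (act0 hact) smul0l !addr0.
  by rewrite c1_cocycle !(act0 hact) !smul0l smul0r !addr0.
- case=> [|x [|//]] _; rewrite /circ !fctE /= /sstar /=.
    by rewrite sadj0 smul0l !addr0.
  by rewrite c1_skew sadj0 !smul0l smul0r !addr0 subrr.
- by case: ltngtP.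
Qed.

Lemma formal_deformation : exists U, deforms U /\
  forall k, [/\ mult_upto k U, unit_upto k U & bound_upto k U].
Proof.
have [D0 m0 u0 b0] := deformation_base.
set base := (fun g w => _) in D0 m0 u0 b0.
pose good k U := [/\ deforms U, mult_upto k U, unit_upto k U & bound_upto k U].
have /choice[f fP] : forall kU : nat * (G -> seq X -> V), exists U',
    (0 < kU.1)%N -> good kU.1 kU.2 ->
    good kU.1.+1 U' /\ forall g, eqm kU.1 (U' g) (kU.2 g).
  move=> [k U] /=.
  have [[k0 [dU mU uU bU]]|ngood] := pselect ((0 < k)%N /\ good k U).
    have [U' [dU' mU' uU' bU' eU']] := deformation_step k0 dU mU uU bU.
    by exists U'.
  by exists U => k0 gU; exfalso; apply: ngood.
pose Us := fix Us j := if j is j'.+1 then f (j, Us j') else base.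
have goodU j : good j.+1 (Us j).
  by elim: j => [//|j IH]; exact: (fP (j.+1, Us j) _ IH).1.
have eqU j l g : (j <= l)%N -> eqm j.+1 (Us l g) (Us j g).
  elim: l => [|l IH]; first by rewrite leqn0 => /eqP ->.
  rewrite leq_eqVlt => /predU1P[->//|jl].
  apply: eqm_trans (IH jl); apply: eqm_leq ((fP (l.+1, Us l) _ (goodU l)).2 g) => //.
(* Later stages never alter words of length at most [j + 1] in [Us j], so stage [size w] already
   carries the final coefficient of [w]. *)
pose U g w := Us (size w) g w.
have UE k g : eqm k.+1 (U g) (Us k g).
  move=> w wk; rewrite /U; have [wk'|wk'] := leqP (size w) k.
    by rewrite (eqU _ _ _ wk').
  by apply: (eqU k) => //; exact: ltnW.
exists U; split.
  by split=> [g|g x]; rewrite (UE 0%N)//=; case: D0 => ? ?.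
move=> k; have {}UE g := eqm_leq (leqnSn k) (UE k g).
have [_ mk uk bk] := goodU k; split.
- move=> g h; apply: (eqm_trans (UE _)).
  apply: (eqm_trans (eqm_leq (leqnSn k) (mk g h))).
  by apply: eqm_circ; [|apply: eqm_sact]; exact/eqm_sym.
- move=> g; apply: (eqm_trans (eqm_circ (UE g) (eqm_sstar (UE g)))).
  exact: eqm_leq (leqnSn k) (uk g).
- move=> w g gs /andP[w1 wk]; rewrite UE//.
  have -> : conv (U g) (sstar (U g)) w = conv (Us k g) (sstar (Us k g)) w.
    exact: (eqm_conv (UE g) (eqm_sstar (UE g))).
  have cn v : (size v <= k)%N -> conv_norm U v = conv_norm (Us k) v.
    move=> vk; apply: eq_bigr => i _; congr (`|_|).
    exact: (eqm_conv (UE _) (eqm_sact _ (UE _))).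
  by rewrite cn// cn ?size_rev// bk// w1 leqW.
Qed.

End Deformation.

(** * The radius of convergence *)

Section Convergence.
Variables (R : realType) (V : banachStarType R) (G : groupType).
Variable act : G -> V -> V.
Hypothesis hact : star_action act.
Variables (X : finType) (s : seq G) (E : seq (G * G)) (C : R).
Hypothesis hs : forall K : {pred G},
  group_closed K -> {subset s <= K} -> K =i predT.
Hypothesis C0 : 0 <= C.
Variables (c1 : X -> G -> V) (U : G -> seq X -> V).
Hypothesis dU : deforms c1 U.
Hypothesis mU : forall g h, U (g * h)%g = circ (U g) (sact act g (U h)).
Hypothesis uU : forall g, circ (U g) (sstar (U g)) = 0.
Hypothesis bU : forall k, bound_upto act s E C k U.
Implicit Types (r : R) (k : nat) (g h : G).

Let U0 g : U g [::] = 0. Proof. exact: dU.1. Qed.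

Lemma deformation1 : U 1%g = 0.
Proof.
apply: (circ_inj (U0 1%g)); rewrite circ0.
have := mU 1%g 1%g; rewrite mulg1 (_ : sact act 1%g (U 1%g) = U 1%g)//.
by apply/funext => w; exact: (act1 hact).
Qed.

(** Both sides are right inverses of [U g] for [circ]. Through this identity, inverses in [G] cost
    nothing in norm, since the action and the involution are isometric. *)
Lemma deformationV g : sact act g (U g^-1%g) = sstar (U g).
Proof. by apply: (circ_inj (U0 g)); rewrite uU -mU mulgV deformation1. Qed.

Definition total_norm r k : R := \sum_(g <- s) wnorm r k (U g).

Lemma wnorm_sact r k g (a : seq X -> V) : wnorm r k (sact act g a) = wnorm r k a.
Proof. by apply: eq_bigr => w _; rewrite /sact (act_norm hact). Qed.

Lemma total_norm_ge0 r k : 0 <= r -> 0 <= total_norm r k.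
Proof. by move=> r0; apply: sumr_ge0 => g _; exact: wnorm_ge0. Qed.

Lemma wnorm_le_total r k g : 0 <= r -> g \in s -> wnorm r k (U g) <= total_norm r k.
Proof.
move=> r0 gs; rewrite /total_norm (big_rem g)//= lerDl.
by apply: sumr_ge0 => h _; exact: wnorm_ge0.
Qed.

(** [L] is the number of generators or inverses in an expression for [g]. It depends neither on [r]
    nor on [k], so one radius can be chosen before the induction on [k]. *)
Lemma wnorm_le_expr g : exists L, forall r k, 0 <= r ->
  1 + wnorm r k (U g) <= (1 + total_norm r k) ^+ L.
Proof.
elim/(gen_ind hs): g => [g gs||g h [L gL] [M hM]|g [L gL]].
- by exists 1%N => r k r0; rewrite expr1 lerD2l wnorm_le_total.
- exists 0%N => r k r0; rewrite deformation1 expr0 /wnorm big1 ?addr0// => w _.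
  by rewrite normr0 mulr0.
- exists (L + M)%N => r k r0; rewrite exprD mU.
  apply: le_trans (wnorm_circ r0 k _ _) _; rewrite wnorm_sact.
  by rewrite ler_pM ?gL ?hM// addr_ge0// wnorm_ge0.
- by exists L => r k r0; rewrite -(wnorm_sact _ _ g) deformationV wnorm_sstar gL.
Qed.

(** The right-hand side is the chord of the convex function [(1 + x) ^+ L] between 0 and 1. *)
Lemma expr1D_le (x : R) L : 0 <= x <= 1 -> (1 + x) ^+ L <= 1 + (2 ^+ L - 1) * x.
Proof.
move=> /andP[x0 x1]; elim: L => [|L IH]; first by rewrite !expr0 subrr mul0r addr0.
rewrite !exprS; apply: le_trans (ler_wpM2l _ IH) _; first by rewrite addr_ge0.
have : 0 <= (2 ^+ L - 1) * x * (1 - x).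
  by rewrite !mulr_ge0 ?subr_ge0// exprn_ege1// ler1n.
nra.
Qed.

Lemma wnorm_le_linear g : exists2 D, 0 <= D & forall r k, 0 <= r ->
  total_norm r k <= 1 -> wnorm r k (U g) <= D * total_norm r k.
Proof.
have [L gL] := wnorm_le_expr g; exists (2 ^+ L - 1).
  by rewrite subr_ge0 exprn_ege1// ler1n.
move=> r k r0 A1; rewrite -(lerD2l 1); apply: le_trans (gL _ _ r0) _.
by rewrite expr1D_le// total_norm_ge0.
Qed.

Lemma sum_wnorm_le_quadratic (F : seq (G * G)) : exists2 D, 0 <= D &
  forall r k, 0 <= r -> total_norm r k <= 1 ->
  \sum_(i <- F) wnorm r k (U i.1) * wnorm r k (U i.2) <= D * total_norm r k ^+ 2.
Proof.
elim: F => [|[g h] F [D D0 FD]].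
  by exists 0 => // r k r0 _; rewrite big_nil mul0r.
have [B B0 gB] := wnorm_le_linear g; have [B' B'0 hB] := wnorm_le_linear h.
exists (B * B' + D) => [|r k r0 A1]; first by rewrite addr_ge0 ?mulr_ge0.
rewrite big_cons mulrDl lerD ?FD//= expr2 mulrACA.
by rewrite ler_pM ?wnorm_ge0 ?gB ?hB.
Qed.

Lemma wnorm_le_step r k g : 0 <= r -> g \in s ->
  wnorm r k.+1 (U g) <= r * \sum_x `|c1 x g|
    + 2 * C * \sum_(i <- E) wnorm r k (U i.1) * wnorm r k (U i.2)
    + wnorm r k (U g) ^+ 2.
Proof.
move=> r0 gs.
(* Words of length one are prescribed by [c1] and escape the recursive bound; [base] accounts for
   them separately. *)
pose base : seq X -> V := fun w => if w is [:: x] then c1 x g else 0.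
pose cn w := conv_norm act E U w.
have cn0 w : 0 <= cn w by apply: sumr_ge0.
have Uw w : r ^+ size w * `|U g w| <= r ^+ size w * `|base w|
    + (r ^+ size w * (C * cn w) + r ^+ size w * (C * cn (rev w)))
    + r ^+ size w * `|conv (U g) (sstar (U g)) w|.
  rewrite -!mulrDr ler_wpM2l ?exprn_ge0//.
  case: w => [|x [|y w]].
  - by rewrite U0 normr0 !addr_ge0 ?mulr_ge0 ?addr_ge0 ?normr_ge0.
  - by rewrite dU.2 -addrA lerDl addr_ge0 ?mulr_ge0 ?addr_ge0.
  - rewrite /base normr0 add0r.
    by apply: (@bU (size w).+2 _ _ gs); rewrite /= leqnn.
apply: le_trans (ler_sum _ (fun w _ => Uw w)) _.
rewrite !big_split /= -/(wnorm r k.+1 base) -/(wnorm r k.+1 (conv _ _)).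
rewrite lerD//; last first.
  apply: le_trans (wnorm_conv_low r0 k (U0 g) _) _.
    by rewrite /sstar U0 sadj0.
  by rewrite wnorm_sstar expr2.
rewrite lerD//.
  rewrite wnormS /base normr0 add0r; apply: ler_wpM2l => //; apply: ler_sum => x _.
  rewrite -/base (_ : (fun v => base (x :: v)) = trunc 0 (fun=> c1 x g)).
    by rewrite wnorm_trunc// wnorm0.
  by apply/funext => -[].
(* The word and its reversal contribute equally to the sum over all words, whence the factor
   [2 * C]. *)
have -> : \sum_(w <- words X k.+1) r ^+ size w * (C * cn (rev w)) =
          \sum_(w <- words X k.+1) r ^+ size w * (C * cn w).
  rewrite -[RHS](perm_big _ (perm_words_rev X k.+1)) big_map.
  by apply: eq_bigr => w _; rewrite size_rev.
apply: (@le_trans _ _ (2 * (C * \sum_(w <- words X k.+1) r ^+ size w * cn w))).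
  rewrite mulr_sumr mulr2n mulrDl mul1r lerD//; apply: ler_sum => w _;
    by rewrite mulrCA.
rewrite -mulrA ler_pM2l// ler_wpM2l//.
under [leLHS]eq_bigr do rewrite mulr_sumr.
rewrite [leLHS]exchange_big /=.
apply: ler_sum => i _; apply: le_trans (wnorm_conv_low r0 k (U0 _) _) _.
  exact: sact_nil.
by rewrite wnorm_sact.
Qed.

Lemma deformation_radius : exists2 r, 0 < r &
  forall g, exists M, forall k, wnorm r k (U g) <= M.
Proof.
have [D D0 ED] := sum_wnorm_le_quadratic E.
pose A1 := \sum_(g <- s) \sum_x `|c1 x g|.
have A10 : 0 <= A1 by apply: sumr_ge0 => g _; exact: sumr_ge0.
(* [K] is the coefficient of the quadratic term of the recursion, its summand 1 coming from the
   product of [U g] with its star. The choice [x0 = 1 / (2 * K)] gives [K * x0 ^+ 2 = x0 / 2], and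
   [r] makes the linear term at most [x0 / 2], so the bound [x0] reproduces itself; [1 <= K] ensures
   [x0 <= 1]. *)
pose K := (size s)%:R * (2 * C * D) + 1.
have K1 : 1 <= K by rewrite lerDr !mulr_ge0.
pose x0 := (2 * K)^-1; pose r := x0 / 2 / (A1 + 1).
have K0 : 0 < K by exact: lt_le_trans K1.
have x00 : 0 < x0 by rewrite invr_gt0 mulr_gt0.
have x01 : x0 <= 1 by rewrite invf_le1 ?mulr_gt0//; lra.
have r0 : 0 < r by rewrite !divr_gt0// ltr_wpDl.
have rA : r * A1 <= x0 / 2.
  rewrite /r -mulrA ler_piMr ?divr_ge0 ?(ltW x00)//.
  by rewrite mulrC ler_pdivrMr ?ltr_wpDl// mul1r lerDl.
have Ax k : total_norm r k <= x0.
  elim: k => [|k IH].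
    rewrite /total_norm big1 ?ltW// => g _; by rewrite wnorm0 U0 normr0.
  have A1' : total_norm r k <= 1 by exact: le_trans x01.
  have Ak0 := total_norm_ge0 k (ltW r0).
  have step : total_norm r k.+1 <= r * A1
      + (size s)%:R * (2 * C * (D * total_norm r k ^+ 2)) + total_norm r k ^+ 2.
    rewrite {1}/total_norm.
    apply: (@le_trans _ _ (\sum_(g <- s) (r * \sum_x `|c1 x g|
      + 2 * C * (D * total_norm r k ^+ 2) + total_norm r k * wnorm r k (U g)))).
      rewrite big_seq [leRHS]big_seq; apply: ler_sum => g gs.
      apply: le_trans (wnorm_le_step k (ltW r0) gs) _.
      rewrite lerD//; first by rewrite lerD2l ler_wpM2l ?mulr_ge0// ED// ltW.
      by rewrite expr2 ler_wpM2r ?wnorm_ge0 ?wnorm_le_total ?ltW.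
    rewrite !big_split /= -mulr_sumr -/A1 -[X in _ + X <= _]mulr_sumr
      -/(total_norm r k) -expr2.
    by rewrite big_const_seq count_predT iter_addr_0 [(size s)%:R * _]mulr_natl.
  apply: le_trans step _.
  have : K * total_norm r k ^+ 2 <= x0 / 2.
    apply: (@le_trans _ _ (K * x0 ^+ 2)).
      by apply: ler_wpM2l; [exact: ltW|apply: lerXn2r; rewrite ?nnegrE ?Ak0 ?(ltW x00)].
    by rewrite le_eqVlt /x0; apply/orP; left; apply/eqP; field; rewrite gt_eqF.
  rewrite /K; set a := total_norm r k ^+ 2; set n := (size s)%:R.
  move=> h; have -> : n * (2 * C * (D * a)) = n * (2 * C * D) * a by rewrite !mulrA.
  move: h; rewrite mulrDl mul1r; lra.
exists r => // g; have [B B0 gB] := wnorm_le_linear g.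
exists (B * x0) => k; apply: le_trans (gB _ _ (ltW r0) (le_trans (Ax k) x01)) _.
by rewrite ler_wpM2l.
Qed.

End Convergence.

Theorem analytic_deformation (R : realType) (V : banachStarType R) (G : groupType)
    (act : G -> V -> V) (X : finType) (s : seq G) (c1 : X -> G -> V) :
  star_action act ->
  (forall K : {pred G}, group_closed K -> {subset s <= K} -> K =i predT) ->
  (forall z, cocycle2 act z -> exists b, d1 act b = z) ->
  (forall x g h, c1 x (g * h)%g = c1 x g + act g (c1 x h)) ->
  (forall x g, sadj (c1 x g) = - c1 x g) ->
  exists (U : G -> seq X -> V) (r : R), [/\ deforms c1 U,
    forall g h, U (g * h)%g = circ (U g) (sact act g (U h)),
    forall g, circ (U g) (sstar (U g)) = 0,
    0 < r & forall g, exists M, forall k, wnorm r k (U g) <= M].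
Proof.
move=> hact hs H2 c1_cocycle c1_skew.
have [E [C [C0 lift]]] := lift_bound hact hs H2.
have [U [dU hU]] := formal_deformation hact lift c1_cocycle c1_skew.
have mU g h : U (g * h)%g = circ (U g) (sact act g (U h)).
  by apply/funext => w; have [mU _ _] := hU (size w); exact: mU.
have uU g : circ (U g) (sstar (U g)) = 0.
  by apply/funext => w; have [_ uU _] := hU (size w); exact: uU.
have bU k : bound_upto act s E C k U by have [] := hU k.
have [r r0 hr] := deformation_radius hact hs C0 dU mU uU bU.
by exists U, r.
Qed.

#[local] Existing Instance totally_filter.

(** * Hilbert spaces and Hilbert-Schmidt operators *)

Section InnerProduct.
Variables (R : realType) (H : hilbertType R).
Local Open Scope complex_scope.
Implicit Types (x y v : H) (a b : R[i]).

Local Notation Re := complex.Re.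

Lemma ReD a b : Re (a + b) = Re a + Re b. Proof. by case: a; case: b. Qed.
Lemma ReN a : Re (- a) = - Re a. Proof. by case: a. Qed.
Lemma ReZ (k : R) a : Re (k%:C * a) = k * Re a.
Proof. by case: a => r i /=; rewrite mul0r subr0. Qed.

Definition abs2 a : R := Re (a * conjc a).

Lemma abs2E a : (abs2 a)%:C = a * conjc a.
Proof.
apply/eqP; rewrite eq_complex /=; apply/andP; split => //.
by case: a => r i /=; rewrite mulrN mulrC addNr.
Qed.

Lemma abs2_ge0 a : 0 <= abs2 a.
Proof. by rewrite -ler0c abs2E mulcJ_ge0. Qed.

Lemma abs2_conj a : abs2 (conjc a) = abs2 a.
Proof. by rewrite /abs2 conjcK mulrC. Qed.

Lemma abs2_eq0 a : abs2 a = 0 -> a = 0.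
Proof.
move=> a0; have : a * conjc a = 0 by rewrite -abs2E a0.
by move/eqP; rewrite mulf_eq0 conjc_eq0 orbb => /eqP.
Qed.

Lemma dotDl x y z : hdot (x + y) z = hdot x z + hdot y z.
Proof. exact: linearDl. Qed.
Lemma dotDr x y z : hdot x (y + z) = hdot x y + hdot x z.
Proof. exact: linearDr. Qed.
Lemma dotZl a x y : hdot (a *: x) y = a * hdot x y.
Proof. exact: linearZl_LR. Qed.
Lemma dotZr a x y : hdot x (a *: y) = conjc a * hdot x y.
Proof. exact: linearZr_LR. Qed.
Lemma dotNl x y : hdot (- x) y = - hdot x y.
Proof. exact: linearNl. Qed.
Lemma dotNr x y : hdot x (- y) = - hdot x y.
Proof. exact: linearNr. Qed.
Lemma dotBl x y z : hdot (x - y) z = hdot x z - hdot y z.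
Proof. by rewrite dotDl dotNl. Qed.
Lemma dotBr x y z : hdot x (y - z) = hdot x y - hdot x z.
Proof. by rewrite dotDr dotNr. Qed.
Lemma dotC x y : hdot y x = conjc (hdot x y).
Proof. by rewrite hermC expr0 mul1r. Qed.
Lemma dot0l x : hdot 0 x = 0. Proof. exact: linear0l. Qed.
Lemma dot0r x : hdot x 0 = 0. Proof. exact: linear0r. Qed.
Lemma dot_suml (I : Type) (r : seq I) (P : pred I) (F : I -> H) x :
  hdot (\sum_(i <- r | P i) F i) x = \sum_(i <- r | P i) hdot (F i) x.
Proof. by apply: (big_morph (hdot^~ x)) => [u v|]; rewrite ?dotDl ?dot0l. Qed.

(* The norm of H takes values in R[i]; [hn] is the same norm with values in R. *)
Definition hn x : R := Re `|x|.
Definition sqn x : R := Re (hdot x x).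

Lemma hnE x : `|x| = (hn x)%:C.
Proof. by rewrite /hn RRe_real// ger0_real. Qed.

Lemma hn_ge0 x : 0 <= hn x.
Proof. by rewrite -ler0c -hnE. Qed.

Lemma sqnE x : hdot x x = (sqn x)%:C.
Proof. by rewrite /sqn hdot_norm hnE -rmorphXn. Qed.

Lemma sqn_hn x : sqn x = hn x ^+ 2.
Proof. by rewrite /sqn hdot_norm hnE -rmorphXn. Qed.

Lemma sqn_ge0 x : 0 <= sqn x.
Proof. by rewrite sqn_hn exprn_ge0// hn_ge0. Qed.

Lemma sqn_eq0 x : sqn x = 0 -> x = 0.
Proof.
move=> /eqP; rewrite sqn_hn expf_eq0 /= => /eqP x0.
by apply/normr0_eq0; rewrite hnE x0.
Qed.

Lemma sqn0 : sqn 0 = 0. Proof. by rewrite /sqn dot0l. Qed.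

Lemma sqnN x : sqn (- x) = sqn x.
Proof. by rewrite /sqn dotNl dotNr opprK. Qed.

Lemma sqnZ a x : sqn (a *: x) = abs2 a * sqn x.
Proof. by rewrite /sqn dotZl dotZr sqnE mulrA -abs2E -rmorphM. Qed.

Lemma sqnD x y : sqn (x + y) = sqn x + sqn y + 2 * Re (hdot x y).
Proof.
rewrite /sqn dotDl !dotDr !ReD (dotC x y).
have -> : Re (conjc (hdot x y)) = Re (hdot x y) by case: (hdot x y).
by rewrite mulr2n mulrDl mul1r !addrA [LHS](ACl (1*4*2*3)).
Qed.

Lemma sqnB x y : sqn (x - y) = sqn x + sqn y - 2 * Re (hdot x y).
Proof. by rewrite sqnD sqnN dotNr ReN mulrN. Qed.

(* Young's inequality: a triangle inequality for squared norms that can be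
   summed termwise. *)
Lemma sqnD_young (k : R) x y : 0 < k ->
  sqn (x + y) <= (1 + k) * sqn x + (1 + k^-1) * sqn y.
Proof.
move=> k0; rewrite sqnD !mulrDl !mul1r.
have : 0 <= k^-1 * sqn (k%:C *: x - y).
  by rewrite mulr_ge0 ?sqn_ge0// invr_ge0 ltW.
rewrite sqnB sqnZ dotZl ReZ /abs2 conjc_real ReZ /= mulrDr mulrN mulrDr !mulrA.
rewrite mulVf ?gt_eqF// mul1r [k^-1 * 2]mulrC -[2 * k^-1 * k]mulrA mulVf ?gt_eqF// mulr1.
lra.
Qed.

Lemma cauchy_schwarz x y : abs2 (hdot x y) <= sqn x * sqn y.
Proof.
have [y0|] := eqVneq (sqn y) 0.
  by rewrite (sqn_eq0 y0) dot0r sqn0 mulr0 /abs2 mul0r.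
move=> yn0; have y0 : 0 < sqn y by rewrite lt0r yn0 sqn_ge0.
have := sqn_ge0 ((sqn y)%:C *: x - hdot x y *: y).
rewrite sqnB !sqnZ dotZl dotZr ReZ -/(abs2 _) [conjc _ * _]mulrC -/(abs2 _).
have -> : abs2 (sqn y)%:C = sqn y ^+ 2 by rewrite /abs2 conjc_real ReZ expr2.
move=> h; rewrite -(ler_pM2l y0); lra.
Qed.

Lemma cvg_hnP (I : Type) (F : set_system I) {FF : Filter F} (f : I -> H) x :
  f @ F --> x <-> forall e : R, 0 < e -> \forall i \near F, hn (x - f i) < e.
Proof.
split=> [/cvgrPdist_lt fx e e0|fx].
  have /fx : 0 < e%:C by rewrite ltcR.
  by apply: filterS => i; rewrite hnE ltcR.
apply/cvgrPdist_lt => e e0; have eE : e = (Re e)%:C by rewrite RRe_real ?gtr0_real.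
have : 0 < Re e by rewrite -ltcR -eE.
by move=> /fx; apply: filterS => i; rewrite eE hnE ltcR.
Qed.

End InnerProduct.

Section FsetSums.
Variables (R : realType) (T : choiceType).
Implicit Types (A B : {fset T}) (P : pred T).

Lemma sum_fset_sub (W : nmodType) A B P (f : T -> W) : (A `<=` B)%fset ->
  \sum_(e <- B | P e) f e =
  \sum_(e <- A | P e) f e + \sum_(e <- B | P e && (e \notin A)) f e.
Proof.
move=> AB; rewrite (bigID (mem A)) /=; congr (_ + _).
rewrite -big_filter -[RHS]big_filter; apply: perm_big.
apply: uniq_perm; rewrite ?filter_uniq ?fset_uniq// => e.
rewrite !mem_filter -andbA; congr (_ && _).
by case: (boolP (e \in A)) => //= /(fsubsetP AB) ->.
Qed.

Lemma esum_leP (E : set T) (f : T -> R) (M : R) : (forall e, 0 <= f e) ->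
  (\esum_(e in E) (f e)%:E <= M%:E)%E <->
  forall A : {fset T}, \sum_(e <- A | e \in E) f e <= M.
Proof.
move=> f0; split=> [le_M A|le_M].
  rewrite -lee_fin; apply: le_trans le_M; apply: esum_ge.
  exists [set e | e \in [fset e in A | e \in E]%fset].
    split; first exact: finite_fset.
    by move=> e /=; rewrite !inE /= => /andP[_]; rewrite inE.
  rewrite fsbig_finite ?finite_fset//= set_fsetK sumEFin lee_fin big_fset /=.
  by rewrite le_eqVlt eqxx.
apply: ge_ereal_sup => _ [A [finA AE] <-].
rewrite fsbig_finite//= sumEFin lee_fin; apply: le_trans (le_M (fset_set A)).
rewrite [leRHS]big_mkcond /= le_eqVlt; apply/orP; left; apply/eqP.
apply: eq_big_seq => e; rewrite in_fset_set// inE => /AE Ee.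
by rewrite mem_set.
Qed.

End FsetSums.

(** * Orthonormal bases, Parseval's identity and the Riesz representation theorem *)

Section OrthonormalBases.
Variables (R : realType) (H : hilbertType R).
Local Notation Re := complex.Re.
Local Open Scope complex_scope.
Implicit Types (x y v e : H) (E : set H) (A : {fset H}) (a : H -> R[i]).

Definition orthonormal E := forall x y, E x -> E y -> hdot x y = (x == y)%:R.

Lemma sqn_orthonormal_sum E a (r : seq H) (P : pred H) : orthonormal E ->
  uniq r -> (forall e, P e -> E e) ->
  sqn (\sum_(e <- r | P e) a e *: e) = \sum_(e <- r | P e) abs2 (a e).
Proof.
move=> oE + PE; elim: r => [|x r IH] /=; first by rewrite !big_nil sqn0.
move=> /andP[xr ur]; rewrite !big_cons; case: ifP => Px; last exact: IH.
rewrite sqnD IH// sqnZ dotC dot_suml [X in conjc X]big1_seq; last first.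
  move=> e /andP[Pe er]; rewrite dotZl dotZr (oE _ _ (PE _ Pe) (PE _ Px)).
  by case: eqP => [exr|_]; [rewrite -exr er in xr|rewrite !mulr0].
by rewrite (_ : Re _ = 0)// mulr0 addr0 /sqn (oE _ _ (PE _ Px) (PE _ Px)) eqxx mulr1.
Qed.

Lemma bessel_sum E v (r : seq H) (P : pred H) : orthonormal E ->
  uniq r -> (forall e, P e -> E e) ->
  sqn (v - \sum_(e <- r | P e) hdot v e *: e) =
  sqn v - \sum_(e <- r | P e) abs2 (hdot v e).
Proof.
move=> oE ur PE; rewrite sqnB (sqn_orthonormal_sum _ oE)// [hdot v _]dotC dot_suml.
set S := \sum_(e <- r | P e) abs2 _.
rewrite (eq_bigr (fun e => (abs2 (hdot v e))%:C)) => [|e _]; last first.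
  by rewrite dotZl [hdot e v]dotC abs2E.
rewrite -rmorph_sum conjc_real /= -/S mulr2n mulrDl mul1r; lra.
Qed.

Lemma abs2_small (z : R[i]) : (forall e : R, 0 < e -> abs2 z <= e) -> z = 0.
Proof.
move=> ze; apply: abs2_eq0; apply/le_anti; rewrite abs2_ge0 andbT.
by apply/ler_addgt0Pr => e e0; rewrite add0r ze.
Qed.

Lemma riesz_fischer E a (M : R) : orthonormal E ->
  (forall A, \sum_(e <- A | e \in E) abs2 (a e) <= M) ->
  exists y, (forall e, E e -> hdot y e = a e) /\
    (fun A : {fset H} => \sum_(e <- A | e \in E) a e *: e) @ totally --> y.
Proof.
move=> oE aM; pose S A := \sum_(e <- A | e \in E) abs2 (a e).
pose w A := \sum_(e <- A | e \in E) a e *: e.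
have supS : has_sup (range S).
  by split; [exists (S fset0), fset0|exists M => _ [A _ <-]; exact: aM].
have wS (A B : {fset H}) : (A `<=` B)%fset -> sqn (w B - w A) = S B - S A.
  move=> AB; rewrite /w /S (sum_fset_sub (mem E) (fun e => a e *: e) AB).
  rewrite (sum_fset_sub (mem E) (fun e => abs2 (a e)) AB).
  rewrite [LHS](_ : _ = sqn (\sum_(e <- B | (e \in E) && (e \notin A)) a e *: e)).
    rewrite [RHS]addrAC subrr add0r.
    by apply: (sqn_orthonormal_sum _ oE) => [|e /andP[]]; rewrite ?fset_uniq ?inE.
  by rewrite addrAC subrr add0r.
have cw : cvg (w @ totally).
  apply/cauchy_cvgP/cauchy_exP => e e0.
  have eE : e = (Re e)%:C by rewrite RRe_real ?gtr0_real.
  have re0 : 0 < Re e by rewrite -ltcR -eE.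
  have re2 : 0 < Re e ^+ 2 by rewrite exprn_gt0.
  (* [A] comes within the square of the radius of the supremum of all partial sums, so enlarging it
     changes the vector sum by less than the radius. *)
  have [_ [A _ <-] SA] := sup_adherent re2 supS.
  exists (w A); exists A => // B /= AB; rewrite -ball_normE /= distrC hnE eE ltcR.
  rewrite -(ltr_pXn2r (n := 2)) ?nnegrE ?hn_ge0 ?(ltW re0)// -sqn_hn wS//.
  have : S B <= sup (range S) by apply: sup_upper_bound => //; exists B.
  lra.
have {cw} [y wy] : exists y, w @ totally --> y by exists (lim (w @ totally)).
exists y; split=> // e Ee; apply/eqP; rewrite -subr_eq0; apply/eqP.
apply: abs2_small => d d0.
have /cvg_hnP/(_ (Num.sqrt d)) := wy; rewrite sqrtr_gt0 => /(_ d0)[A _ /= wA].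
have /wA : (A `<=` e |` A)%fset by rewrite fsubsetUr.
pose B := (e |` A)%fset; rewrite -/B => wB.
have -> : a e = hdot (w B) e.
  rewrite dot_suml big_mkcond (bigD1_seq e) ?fset1U1 ?fset_uniq//= mem_set//.
  rewrite dotZl oE// eqxx mulr1 big1 ?addr0// => x xe.
  by case: ifP => // /set_mem Ex; rewrite dotZl oE// (negbTE xe) mulr0.
rewrite -dotBl; apply: le_trans (cauchy_schwarz _ _) _.
rewrite [sqn e]/sqn oE// eqxx mulr1 sqn_hn -(sqr_sqrtr (ltW d0)).
by rewrite lerXn2r ?nnegrE ?hn_ge0 ?sqrtr_ge0// ltW.
Qed.

Lemma bessel E v A : orthonormal E ->
  \sum_(e <- A | e \in E) abs2 (hdot v e) <= sqn v.
Proof.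
move=> oE; rewrite -subr_ge0.
by rewrite -(bessel_sum _ oE) ?sqn_ge0 ?fset_uniq// => e; rewrite inE.
Qed.

(** The coefficients of [v] are those of some convergent sum [y], and [v - y] is orthogonal to the
    basis, hence zero. *)
Lemma basis_expansion E v : orthonormal_basis E ->
  (fun A : {fset H} => \sum_(e <- A | e \in E) hdot v e *: e) @ totally --> v.
Proof.
move=> [oE E0].
have [y [yE wy]] := riesz_fischer oE (fun A => bessel v A oE).
suff vy : v = y by rewrite -vy in wy.
apply/eqP; rewrite -subr_eq0; apply/eqP/E0 => e Ee.
by rewrite dotBl yE// subrr.
Qed.

Lemma parseval E v : orthonormal_basis E ->
  (sqn v)%:E = (\esum_(e in E) (abs2 (hdot v e))%:E)%E.
Proof.
move=> bE; have oE := bE.1.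
have le_v : (\esum_(e in E) (abs2 (hdot v e))%:E <= (sqn v)%:E)%E.
  by apply/esum_leP => [e|A]; [exact: abs2_ge0|exact: bessel].
apply/le_anti; rewrite le_v andbT.
have : (0 <= \esum_(e in E) (abs2 (hdot v e))%:E)%E.
  by apply: esum_ge0 => e _; rewrite lee_fin abs2_ge0.
case Es : (\esum_(e in E) _)%E le_v => [s| |] // _ s0.
rewrite lee_fin; apply/ler_addgt0Pr => d d0.
have /esum_leP leA : (\esum_(e in E) (abs2 (hdot v e))%:E <= s%:E)%E by rewrite Es.
have /cvg_hnP/(_ (Num.sqrt d)) := @basis_expansion _ v bE.
rewrite sqrtr_gt0 => /(_ d0)[A _ /(_ A (fsubset_refl A))] /= hA.
have : sqn (v - \sum_(e <- A | e \in E) hdot v e *: e) <= d.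
  rewrite sqn_hn -[leRHS](sqr_sqrtr (ltW d0)).
  by rewrite lerXn2r ?nnegrE ?hn_ge0 ?sqrtr_ge0// ltW.
rewrite (bessel_sum _ oE) ?fset_uniq//; last by move=> e; rewrite inE.
have := leA (fun e => abs2_ge0 _) A; lra.
Qed.

Lemma onb_exists : exists E, orthonormal_basis E.
Proof.
have [|E [oE maxE]] := @Zorn_bigcup H orthonormal.
  move=> F Fo totF x y [X FX Xx] [Y FY Yy].
  have [XY|YX] := totF _ _ FX FY; first exact: (Fo _ FY) (XY _ Xx) Yy.
  exact: (Fo _ FX) Xx (YX _ Yy).
(* A nonzero vector orthogonal to the maximal orthonormal set could be normalized and added to
   it. *)
exists E; split=> // v vE; apply: contrapT => v0.
have hv0 : hn v != 0 by apply/eqP => hv; apply: v0; apply: sqn_eq0; rewrite sqn_hn hv expr0n.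
pose u := ((hn v)^-1)%:C *: v.
have uu : hdot u u = 1.
  by rewrite sqnE sqnZ /abs2 conjc_real ReZ /= sqn_hn -expr2 exprVn mulVf ?expf_neq0.
have uE e : E e -> hdot u e = 0 by move=> Ee; rewrite dotZl vE// mulr0.
have nEu : ~ E u by move=> /uE/eqP; rewrite uu oner_eq0.
apply: (maxE (E `|` [set u])).
  by rewrite properEneq; split; [apply/eqP => e; apply: nEu; rewrite e; right|left].
move=> x y [Ex|->] [Ey|->]; rewrite ?uu ?eqxx//; first exact: oE.
  by rewrite dotC uE// conjc0; case: eqP => // xu; rewrite -xu in nEu.
by rewrite uE//; case: eqP => // xu; rewrite xu in nEu.
Qed.

(** Existence makes the choice in [onb] a genuine basis, whatever its default value. *)
Lemma onbP : orthonormal_basis (@onb R H).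
Proof. by have [E bE] := onb_exists; exact: (xgetPex _ (ex_intro _ E bE)). Qed.

Lemma abs2D (z z' : R[i]) : abs2 (z + z') <= 2 * abs2 z + 2 * abs2 z'.
Proof.
case: z => a b; case: z' => c d; rewrite /abs2 /=.
have := sqr_ge0 (a - c); have := sqr_ge0 (b - d); rewrite !expr2; lra.
Qed.

Lemma riesz (f : H -> R[i]) (M : R) : 0 <= M -> (forall x y, f (x + y) = f x + f y) ->
  (forall k x, f (k *: x) = k * f x) -> (forall x, abs2 (f x) <= M * sqn x) ->
  exists y, forall x, f x = hdot x y.
Proof.
move=> M_ge0 fD fZ fM; have bE := onbP; set E := @onb R H in bE; have oE := bE.1.
have f0 : f 0 = 0 by rewrite -(scale0r 0) fZ mul0r.
have fN x : f (- x) = - f x by rewrite -scaleN1r fZ mulN1r.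
have f_sum (r : seq H) (P : pred H) (F : H -> H) :
    f (\sum_(e <- r | P e) F e) = \sum_(e <- r | P e) f (F e).
  exact: (big_morph f fD f0).
(* Testing [f] on the vector with coordinates [conjc (f e)] gives [s ^+ 2 <= M * s], where [s] is
   the squared norm of that vector. *)
have fA A : \sum_(e <- A | e \in E) abs2 (conjc (f e)) <= M.
  set s := \sum_(e <- A | _) _.
  have s0 : 0 <= s by apply: sumr_ge0 => e _; exact: abs2_ge0.
  pose y := \sum_(e <- A | e \in E) conjc (f e) *: e.
  have ys : sqn y = s.
    by apply: (sqn_orthonormal_sum _ oE) => [|e]; rewrite ?fset_uniq ?inE.
  have fy : f y = s%:C.
    rewrite f_sum rmorph_sum; apply: eq_bigr => e _.
    by rewrite fZ abs2_conj mulrC -abs2E.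
  have := fM y; rewrite fy ys {1}/abs2 conjc_real ReZ /=.
  move: s0; rewrite le_eqVlt => /predU1P[<- _|s0] //; by rewrite ler_pM2r.
have [y [yE _]] := riesz_fischer oE fA; exists y => x.
apply/eqP; rewrite -subr_eq0; apply/eqP/abs2_small => d d0.
(* The functional [h] below vanishes on finite combinations of basis vectors and satisfies
   [abs2 (h z) <= K * sqn z], so the expansion of [x] makes [h x] arbitrarily small. The summand 1
   keeps [K] positive. *)
pose K := 2 * `|M| + 2 * sqn y + 1.
have K0 : 0 < K by rewrite ltr_wpDl// addr_ge0// mulr_ge0 ?sqn_ge0.
pose h z := f z - hdot z y.
have hB z z' : h (z - z') = h z - h z'.
  by rewrite /h fD fN dotBl; ring.
have hK z : abs2 (h z) <= K * sqn z.
  apply: le_trans (abs2D _ _) _; rewrite -dotNr.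
  have := cauchy_schwarz z (- y); have := fM z; rewrite sqnN /K.
  have := ler_norm M; have := sqn_ge0 z.
  set A := sqn z; set B := abs2 (hdot _ _); set D := abs2 (f z); set L := `|M|.
  move=> z0 ML h1 h2; have : M * A <= L * A by rewrite ler_wpM2r.
  lra.
have dK0 : 0 < d / K by rewrite divr_gt0.
have /cvg_hnP/(_ (Num.sqrt (d / K))) := @basis_expansion _ x bE.
rewrite sqrtr_gt0 => /(_ dK0)[A _ /(_ A (fsubset_refl A))] /= hA.
rewrite -/(h x) -[h x]subr0.
have <- : h (\sum_(e <- A | e \in E) hdot x e *: e) = 0.
  rewrite /h f_sum dot_suml -sumrB big1// => e; rewrite inE => Ee.
  by rewrite fZ dotZl [hdot e y]dotC yE// conjcK subrr.
rewrite -hB; apply: le_trans (hK _) _; rewrite -ler_pdivlMl// mulrC.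
rewrite sqn_hn -[leRHS](sqr_sqrtr (ltW dK0)).
by rewrite lerXn2r ?nnegrE ?hn_ge0 ?sqrtr_ge0// ltW.
Qed.

End OrthonormalBases.

(** * Adjoints and the Hilbert-Schmidt norm *)

Section BoundedOperators.
Variables (R : realType) (H : hilbertType R).
Local Notation Re := complex.Re.
Local Open Scope complex_scope.
Implicit Types (x y v e : H) (T S : H -> H).

Definition bounded_op T := exists2 M : R, 0 <= M & forall x, sqn (T x) <= M * sqn x.

(** The relation behind [adjoint], free of its default value. It forces [T] to be linear and [S] to
    be unique, and it is stable under sums, compositions and limits. *)
Definition adjoint_pair T S := forall x y, hdot (T x) y = hdot x (S y).

Lemma dot_inj x y : (forall z, hdot x z = hdot y z) -> x = y.
Proof.
move=> e; apply/eqP; rewrite -subr_eq0; apply/eqP/sqn_eq0.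
by rewrite /sqn dotBl e subrr.
Qed.

Lemma adjoint_pairC T S : adjoint_pair T S -> adjoint_pair S T.
Proof. by move=> TS x y; rewrite dotC -TS -dotC. Qed.

Lemma adjoint_pair_linear T S : adjoint_pair T S -> linear T.
Proof.
move=> TS a x y; apply: dot_inj => z.
by rewrite TS !dotDl !dotZl !TS.
Qed.

Lemma adjoint_pairE T S : adjoint_pair T S -> adjoint T = S.
Proof.
move=> TS; have TA : adjoint_pair T (adjoint T) := xgetPex 0 (ex_intro _ S TS).
apply/funext => y; apply: dot_inj => x.
by rewrite (adjoint_pairC TA) (adjoint_pairC TS).
Qed.

Lemma linear_op0 T : linear T -> T 0 = 0.
Proof. by move=> /(_ (-1) 0 0); rewrite scaler0 add0r scaleN1r addNr. Qed.

Lemma linear_opD T x y : linear T -> T (x + y) = T x + T y.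
Proof. by move=> /(_ 1 x y); rewrite !scale1r. Qed.

Lemma linear_opZ T k x : linear T -> T (k *: x) = k *: T x.
Proof. by move=> lT; have := lT k x 0; rewrite (linear_op0 lT) !addr0. Qed.

Lemma linear_opB T x y : linear T -> T (x - y) = T x - T y.
Proof. by move=> lT; rewrite linear_opD// -scaleN1r linear_opZ// scaleN1r. Qed.

Lemma linear_continuous_bounded T : linear T -> continuous T -> bounded_op T.
Proof.
move=> lT cT.
pose f : {linear H -> H} := HB.pack T (GRing.isLinear.Build _ _ _ _ T lT).
have /linear_bounded_continuous/linear_boundedP/pinfty_ex_gt0[r r0 fr] :
  continuous f by exact: cT.
have rE : r = (Re r)%:C by rewrite RRe_real ?gtr0_real.
exists (Re r ^+ 2) => [|x]; first exact: sqr_ge0.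
have := fr x; rewrite rE !hnE -rmorphM lecR => Tx.
rewrite !sqn_hn -exprMn lerXn2r ?nnegrE ?hn_ge0// mulr_ge0 ?hn_ge0//.
by rewrite -ler0c -rE ltW.
Qed.

Lemma bounded_continuous T : linear T -> bounded_op T -> continuous T.
Proof.
move=> lT [M M0 TM] x; apply/cvg_hnP => e e0.
pose K := M + 1; have K0 : 0 < K by rewrite ltr_wpDl.
have sK0 : 0 < Num.sqrt K by rewrite sqrtr_gt0.
have d0 : 0 < e / Num.sqrt K by rewrite divr_gt0.
have : id @ nbhs x --> x by exact: cvg_id.
move=> /cvg_hnP/(_ _ d0); apply: filterS => y /= xy.
rewrite -linear_opB// -(ltr_pXn2r (n := 2)) ?nnegrE ?hn_ge0 ?(ltW e0)// -sqn_hn.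
apply: le_lt_trans (TM _) _; apply: (@le_lt_trans _ _ (K * sqn (x - y))).
  by rewrite ler_wpM2r ?sqn_ge0// lerDl.
rewrite sqn_hn -[K](sqr_sqrtr (ltW K0)) -exprMn ltrXn2r//.
  by rewrite ?nnegrE mulr_ge0 ?hn_ge0 ?sqrtr_ge0.
by rewrite mulrC -ltr_pdivlMr.
Qed.

Lemma bounded_adjoint T : linear T -> bounded_op T -> exists S, adjoint_pair T S.
Proof.
move=> lT [M M0 TM].
have /choice[S TS] : forall y, exists z, forall x, hdot (T x) y = hdot x z.
  move=> y; apply: (@riesz _ _ _ (M * sqn y)); first by rewrite mulr_ge0 ?sqn_ge0.
  - by move=> x z; rewrite linear_opD// dotDl.
  - by move=> k x; rewrite linear_opZ// dotZl.
  - move=> x; apply: le_trans (cauchy_schwarz _ _) _.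
    by rewrite mulrAC ler_wpM2r ?sqn_ge0.
by exists S => x y; exact: TS.
Qed.

Definition hs2 T : \bar R := (\esum_(e in @onb R H) (sqn (T e))%:E)%E.

Lemma hs2_ge0 T : (0 <= hs2 T)%E.
Proof. by apply: esum_ge0 => e _; rewrite lee_fin sqn_ge0. Qed.

Lemma hs_normE T S : adjoint_pair T S -> hs_norm T = sqrte (hs2 T).
Proof.
move=> TS; rewrite /hs_norm /trace (adjoint_pairE TS); congr sqrte.
by apply: eq_esum => e _; rewrite /= (adjoint_pairC TS).
Qed.

(** By Parseval both sides are double sums of squared matrix entries over the same basis, and the
    two matrices are conjugate transposes of each other. *)
Lemma hs2_adjoint T S : adjoint_pair T S -> hs2 S = hs2 T.
Proof.
move=> TS; have sumE T' : hs2 T' = (\esum_(k in @onb R H `*` @onb R H)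
    (abs2 (hdot (T' k.1) k.2))%:E)%E.
  transitivity (\esum_(e in @onb R H) \esum_(f in @onb R H)
      (abs2 (hdot (T' e) f))%:E)%E.
    by apply: eq_esum => e _; rewrite (parseval _ (onbP H)).
  rewrite (@esum_esum R _ _ (@onb R H) (fun=> @onb R H)
    (fun e f => (abs2 (hdot (T' e) f))%:E))//.
  by move=> e f _ _; rewrite lee_fin abs2_ge0.
rewrite !sumE (@reindex_esum R _ _ (@onb R H `*` @onb R H) (@onb R H `*` @onb R H)
  (fun k => (k.2, k.1))).
  by apply: eq_esum => -[e f] _ /=; rewrite (adjoint_pairC TS) dotC abs2_conj.
split=> [[e f] []//|[e f] [e' f'] _ _ [-> ->]//|[e f] [Ee Ef]].
by exists (f, e).
Qed.

(** The coordinates of [T x] are the products [hdot x (S e)]; Cauchy-Schwarz and Parseval then bound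
    [sqn (T x)] by [hs2 S]. *)
Lemma hs2_bound T S M : adjoint_pair T S -> (hs2 T <= M%:E)%E ->
  forall x, sqn (T x) <= M * sqn x.
Proof.
move=> TS; rewrite -(hs2_adjoint TS) => /esum_leP hM x.
rewrite -lee_fin (parseval _ (onbP H)); apply/esum_leP => [e|A].
  exact: abs2_ge0.
apply: (@le_trans _ _ (\sum_(e <- A | e \in @onb R H) sqn x * sqn (S e))).
  by apply: ler_sum => e _; rewrite TS cauchy_schwarz.
rewrite -mulr_sumr mulrC ler_wpM2r ?sqn_ge0//.
by apply: hM => e; exact: sqn_ge0.
Qed.

Lemma hs2_comp T S M s : 0 <= M -> (forall x, sqn (T x) <= M * sqn x) ->
  (hs2 S <= s%:E)%E -> (hs2 (T \o S) <= (M * s)%:E)%E.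
Proof.
move=> M0 TM /esum_leP Ss; apply/esum_leP => [e|A]; first exact: sqn_ge0.
apply: (@le_trans _ _ (\sum_(e <- A | e \in @onb R H) M * sqn (S e))).
  by apply: ler_sum => e _; exact: TM.
by rewrite -mulr_sumr ler_wpM2l// Ss// => e; exact: sqn_ge0.
Qed.

Lemma hs2_isometry T S : (forall x, sqn (T x) = sqn x) -> hs2 (T \o S) = hs2 S.
Proof. by move=> isoT; apply: eq_esum => e _; rewrite /= isoT. Qed.

(** An adjoint forces linearity, and a finite [hs2] bounds the operator norm, hence gives
    continuity; conversely, Riesz supplies the adjoint of a continuous operator. This form is easy
    to check on sums, composites and limits. *)
Lemma hilbert_schmidtP T : hilbert_schmidt T <->
  (exists S, adjoint_pair T S) /\ (hs2 T < +oo)%E.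
Proof.
split=> [[lT cT nT]|[[S TS] nT]].
  have [S TS] := bounded_adjoint lT (linear_continuous_bounded lT cT).
  split; first by exists S.
  rewrite ltey; apply/eqP => T_oo; move: nT.
  by rewrite (hs_normE TS) T_oo.
have lT := adjoint_pair_linear TS.
have finT : hs2 T \is a fin_num by rewrite ge0_fin_numE ?hs2_ge0.
split=> //.
  apply: bounded_continuous => //; exists (fine (hs2 T)).
    by rewrite fine_ge0// hs2_ge0.
  by apply: hs2_bound TS _; rewrite fineK.
by rewrite (hs_normE TS) -(fineK finT) ltry.
Qed.

End BoundedOperators.

Section HilbertSchmidtClosure.
Variables (R : realType) (H : hilbertType R).
Local Open Scope complex_scope.
Implicit Types (T S : H -> H) (k : R).

Lemma adjoint_pairD T S T' S' : adjoint_pair T S -> adjoint_pair T' S' ->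
  adjoint_pair (T + T') (S + S').
Proof.
by move=> TS TS' x y; rewrite -[LHS]/(hdot (T x + T' x) y) dotDl TS TS' -dotDr.
Qed.

Lemma adjoint_pairZ k T S : adjoint_pair T S -> adjoint_pair (k%:C *: T) (k%:C *: S).
Proof.
move=> TS x y; rewrite -[LHS]/(hdot (k%:C *: T x) y) dotZl TS.
by rewrite -[RHS]/(hdot x (k%:C *: S y)) dotZr conjc_real.
Qed.

Lemma adjoint_pair_comp T S T' S' : adjoint_pair T S -> adjoint_pair T' S' ->
  adjoint_pair (T \o T') (S' \o S).
Proof. by move=> TS TS' x y; rewrite /= TS TS'. Qed.

Lemma adjoint_pair0 : adjoint_pair (0 : H -> H) 0.
Proof. by move=> x y; exact: etrans (dot0l _) (esym (dot0r _)). Qed.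

Lemma hs2D T S (a b : R) k : 0 < k -> (hs2 T <= a%:E)%E -> (hs2 S <= b%:E)%E ->
  (hs2 (T + S)%R <= ((1 + k) * a + (1 + k^-1) * b)%:E)%E.
Proof.
move=> k0 /esum_leP hT /esum_leP hS; apply/esum_leP => [e|A]; first exact: sqn_ge0.
apply: le_trans (ler_sum _ (fun e _ => sqnD_young (T e) (S e) k0)) _.
rewrite big_split /= -!mulr_sumr lerD// ler_wpM2l ?addr_ge0// ?(ltW k0) ?invr_ge0 ?(ltW k0)//.
  by apply: hT => e; exact: sqn_ge0.
by apply: hS => e; exact: sqn_ge0.
Qed.

Lemma sqnZr k (x : H) : sqn (k%:C *: x) = k ^+ 2 * sqn x.
Proof. by rewrite sqnZ /abs2 conjc_real ReZ expr2. Qed.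

Lemma hs2Z k T a : (hs2 T <= a%:E)%E -> (hs2 (k%:C *: T)%R <= (k ^+ 2 * a)%:E)%E.
Proof.
by apply: (@hs2_comp _ _ (fun x => k%:C *: x)) => [|x]; rewrite ?sqr_ge0// sqnZr.
Qed.

Lemma hs2_0 : hs2 (0 : H -> H) = 0%E.
Proof. by apply: esum1 => e _; rewrite sqn0. Qed.

Lemma hilbert_schmidt0 : hilbert_schmidt (0 : H -> H).
Proof.
by apply/hilbert_schmidtP; rewrite hs2_0 ltry; split=> //; exists 0; exact: adjoint_pair0.
Qed.

Lemma hs2_fin T : (hs2 T < +oo)%E -> hs2 T = (fine (hs2 T))%:E.
Proof. by move=> T_oo; rewrite fineK// ge0_fin_numE ?hs2_ge0. Qed.

Lemma hilbert_schmidtD T S : hilbert_schmidt T -> hilbert_schmidt S ->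
  hilbert_schmidt (T + S).
Proof.
move=> /hilbert_schmidtP[[T' TT] Tf] /hilbert_schmidtP[[S' SS] Sf].
apply/hilbert_schmidtP; split; first by exists (T' + S'); exact: adjoint_pairD.
have hT : (hs2 T <= (fine (hs2 T))%:E)%E by rewrite -hs2_fin.
have hS : (hs2 S <= (fine (hs2 S))%:E)%E by rewrite -hs2_fin.
exact: le_lt_trans (hs2D ltr01 hT hS) (ltry _).
Qed.

Lemma hilbert_schmidtZ k T : hilbert_schmidt T -> hilbert_schmidt (k%:C *: T).
Proof.
move=> /hilbert_schmidtP[[T' TT] Tf]; apply/hilbert_schmidtP.
split; first by exists (k%:C *: T'); exact: adjoint_pairZ.
have h : (hs2 T <= (fine (hs2 T))%:E)%E by rewrite -hs2_fin.
exact: le_lt_trans (hs2Z k h) (ltry _).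
Qed.

Lemma hilbert_schmidtN T : hilbert_schmidt T -> hilbert_schmidt (- T).
Proof.
move=> /(hilbert_schmidtZ (-1)); congr (hilbert_schmidt _).
by apply/funext => x; rewrite !fctE rmorphN1 scaleN1r.
Qed.

Lemma hilbert_schmidt_comp T S : hilbert_schmidt T -> hilbert_schmidt S ->
  hilbert_schmidt (T \o S).
Proof.
move=> /hilbert_schmidtP[[T' TT] Tf] /hilbert_schmidtP[[S' SS] Sf].
apply/hilbert_schmidtP; split; first by exists (S' \o T'); exact: adjoint_pair_comp.
apply: le_lt_trans (ltry (fine (hs2 T) * fine (hs2 S))).
apply: hs2_comp; rewrite -?hs2_fin// ?fine_ge0 ?hs2_ge0//.
by apply: hs2_bound TT _; rewrite -hs2_fin.
Qed.

Lemma hilbert_schmidt_pair T : hilbert_schmidt T -> adjoint_pair T (adjoint T).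
Proof. by move=> /hilbert_schmidtP[[T' TT] _]; rewrite (adjoint_pairE TT). Qed.

Lemma hilbert_schmidt_adjoint T : hilbert_schmidt T -> hilbert_schmidt (adjoint T).
Proof.
move=> hT; have TT := hilbert_schmidt_pair hT; move/hilbert_schmidtP : hT => [_ Tf].
apply/hilbert_schmidtP; split; first by exists T; exact: adjoint_pairC.
by rewrite (hs2_adjoint TT).
Qed.

End HilbertSchmidtClosure.

(** * The Banach star-algebra of Hilbert-Schmidt operators *)

Section HilbertSchmidtOperators.
Variables (R : realType) (H : hilbertType R).
Local Open Scope complex_scope.

Record hsop := HSop { hsfun :> H -> H; hsopP : hilbert_schmidt hsfun }.
Implicit Types (A B : hsop) (k : R).

Lemma hsop_ext A B : A =1 B -> A = B.
Proof.
case: A B => [f hf] [g hg] /= /funext fg; case: _ / fg in hg *.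
by rewrite (Prop_irrelevance hf hg).
Qed.

HB.instance Definition _ := gen_eqMixin hsop.
HB.instance Definition _ := gen_choiceMixin hsop.

Definition hsop0 := HSop (@hilbert_schmidt0 R H).
Definition hsopN A := HSop (hilbert_schmidtN (hsopP A)).
Definition hsopD A B := HSop (hilbert_schmidtD (hsopP A) (hsopP B)).
Definition hsopZ k A := HSop (hilbert_schmidtZ k (hsopP A)).
Definition hsopM A B := HSop (hilbert_schmidt_comp (hsopP A) (hsopP B)).
Definition hsop_adj A := HSop (hilbert_schmidt_adjoint (hsopP A)).

Lemma hsopDA : associative hsopD.
Proof. by move=> A B C; apply: hsop_ext => x; rewrite /= !fctE addrA. Qed.
Lemma hsopDC : commutative hsopD.
Proof. by move=> A B; apply: hsop_ext => x; rewrite /= !fctE addrC. Qed.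
Lemma hsop0D : left_id hsop0 hsopD.
Proof. by move=> A; apply: hsop_ext => x; rewrite /= !fctE add0r. Qed.
Lemma hsopND : left_inverse hsop0 hsopN hsopD.
Proof. by move=> A; apply: hsop_ext => x; rewrite /= !fctE addNr. Qed.

HB.instance Definition _ := GRing.isZmodule.Build hsop hsopDA hsopDC hsop0D hsopND.

Lemma hsopZA k l A : hsopZ k (hsopZ l A) = hsopZ (k * l) A.
Proof. by apply: hsop_ext => x; rewrite /= !fctE scalerA rmorphM. Qed.
Lemma hsop1Z : left_id 1 hsopZ.
Proof. by move=> A; apply: hsop_ext => x; rewrite /= !fctE rmorph1 scale1r. Qed.
Lemma hsopZDr : right_distributive hsopZ +%R.
Proof. by move=> k A B; apply: hsop_ext => x; rewrite /= !fctE scalerDr. Qed.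
Lemma hsopZDl A : {morph hsopZ^~ A : k l / k + l}.
Proof. by move=> k l; apply: hsop_ext => x; rewrite /= !fctE rmorphD scalerDl. Qed.

HB.instance Definition _ :=
  GRing.Zmodule_isLmodule.Build R hsop hsopZA hsop1Z hsopZDr hsopZDl.

Definition hsq A : R := fine (hs2 A).
Definition hsn A : R := Num.sqrt (hsq A).

Lemma hsqE A : hs2 A = (hsq A)%:E.
Proof. by apply: hs2_fin; have /hilbert_schmidtP[] := hsopP A. Qed.

Lemma hsq_ge0 A : 0 <= hsq A. Proof. by rewrite fine_ge0// hs2_ge0. Qed.

Lemma hsn_ge0 A : 0 <= hsn A. Proof. exact: sqrtr_ge0. Qed.

Lemma hsn_sqr A : hsn A ^+ 2 = hsq A. Proof. by rewrite sqr_sqrtr// hsq_ge0. Qed.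

Lemma hsop_pair A : adjoint_pair A (hsop_adj A).
Proof. exact: hilbert_schmidt_pair (hsopP A). Qed.

Lemma hs_norm_hsop A : hs_norm A = (hsn A)%:E.
Proof. by rewrite (hs_normE (hsop_pair A)) hsqE. Qed.

Lemma hsop_bound A x : sqn (A x) <= hsq A * sqn x.
Proof. by apply: (hs2_bound (hsop_pair A)); rewrite hsqE. Qed.

Lemma hsq_le A (M : R) : hsq A <= M <-> (hs2 A <= M%:E)%E.
Proof. by rewrite hsqE lee_fin. Qed.

Lemma hsn_le A (M : R) : 0 <= M -> (hsn A <= M) = (hsq A <= M ^+ 2).
Proof. by move=> M0; rewrite -hsn_sqr ler_pXn2r ?nnegrE ?hsn_ge0. Qed.

Lemma hsnD A B : hsn (A + B) <= hsn A + hsn B.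
Proof.
apply/ler_addgt0Pr => e e0; rewrite hsn_le ?addr_ge0 ?hsn_ge0 ?(ltW e0)//.
(* Young's inequality with parameter [t / s] is optimal: [(1 + t / s) * s ^+ 2 + (1 + s / t) * t ^+
   2 = (s + t) ^+ 2]. Half of [e] is added to each norm to keep the denominators positive. *)
pose s := hsn A + e / 2; pose t := hsn B + e / 2.
have s0 : 0 < s by rewrite ltr_wpDl ?hsn_ge0 ?divr_gt0.
have t0 : 0 < t by rewrite ltr_wpDl ?hsn_ge0 ?divr_gt0.
have ts0 : 0 < t / s by rewrite divr_gt0.
have As : (hs2 A <= (s ^+ 2)%:E)%E.
  by apply/hsq_le; rewrite -hsn_le ?(ltW s0)// lerDl divr_ge0 ?(ltW e0).
have Bt : (hs2 B <= (t ^+ 2)%:E)%E.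
  by apply/hsq_le; rewrite -hsn_le ?(ltW t0)// lerDl divr_ge0 ?(ltW e0).
apply/hsq_le; apply: le_trans (hs2D ts0 As Bt) _; rewrite lee_fin.
rewrite le_eqVlt; apply/orP; left; apply/eqP.
have -> : hsn A + hsn B + e = s + t by rewrite /s /t; field.
by field; rewrite !gt_eqF.
Qed.

Lemma hsnZ k A : hsn (k *: A) = `|k| * hsn A.
Proof.
have le_hsn l B : hsn (l *: B) <= `|l| * hsn B.
  rewrite hsn_le ?mulr_ge0 ?hsn_ge0// exprMn hsn_sqr real_normK ?num_real//.
  by apply/hsq_le; apply: hs2Z; rewrite hsqE.
apply/le_anti; rewrite le_hsn /=; have [->|k0] := eqVneq k 0.
  by rewrite normr0 mul0r hsn_ge0.
rewrite -{1}[A](scalerK k0) -ler_pdivlMl ?normr_gt0//.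
by rewrite -normfV le_hsn.
Qed.

Lemma hsn0_eq0 A : hsn A = 0 -> A = 0.
Proof.
move=> A0; apply: hsop_ext => x; apply: sqn_eq0; apply/le_anti.
by rewrite sqn_ge0 andbT; have := hsop_bound A x; rewrite -hsn_sqr A0 expr0n mul0r.
Qed.

HB.instance Definition _ := Lmodule_isNormed.Build R hsop hsnD hsnZ hsn0_eq0.

Lemma hsop_normE A : `|A| = hsn A. Proof. by []. Qed.

End HilbertSchmidtOperators.

Section HilbertSchmidtCompleteness.
Variables (R : realType) (H : hilbertType R).
Local Notation Re := complex.Re.
Local Open Scope complex_scope.
Local Notation hsop := (@hsop R H).
Implicit Types (A B : hsop) (x y : H).

Lemma hsq_adj A : hsq (hsop_adj A) = hsq A.
Proof. by rewrite /hsq (hs2_adjoint (hsop_pair A)). Qed.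

Lemma hsn_adj A : hsn (hsop_adj A) = hsn A.
Proof. by rewrite /hsn hsq_adj. Qed.

Lemma hsop_adjB A B : hsop_adj (A - B) = hsop_adj A - hsop_adj B.
Proof.
apply: hsop_ext => x; apply: dot_inj => z.
rewrite (adjoint_pairC (hsop_pair (A - B))) -[RHS]/(hdot (hsop_adj A x - hsop_adj B x) z).
rewrite dotBl !(adjoint_pairC (hsop_pair _)) -[LHS]/(hdot x (A z - B z)).
by rewrite dotBr.
Qed.

Lemma hn_hsop A x : hn (A x) <= hsn A * hn x.
Proof.
rewrite -(@ler_pXn2r _ 2) ?nnegrE ?mulr_ge0 ?hn_ge0 ?hsn_ge0//.
by rewrite exprMn -!sqn_hn hsn_sqr hsop_bound.
Qed.

Lemma cauchy_hsop_eval (F : set_system hsop) (FF : ProperFilter F) (f : hsop -> H) (C : R) :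
  cauchy F -> (forall A B, hn (f A - f B) <= hsn (A - B) * C) -> cvg (f @ F).
Proof.
move=> /cauchyP cF fC; apply/cauchy_cvgP/cauchy_exP => e e0.
have eE : e = (Re e)%:C by rewrite RRe_real ?gtr0_real.
have re0 : 0 < Re e by rewrite -ltcR -eE.
pose D := `|C| + 1; have D0 : 0 < D by rewrite ltr_wpDl.
have [p Fp] := cF _ (divr_gt0 re0 D0); exists (f p).
suff : F (f @^-1` ball (f p) e) by [].
apply: filterS Fp => A; rewrite /= -!ball_normE /= => pA.
rewrite hnE eE ltcR; apply: le_lt_trans (fC _ _) _.
apply: (@le_lt_trans _ _ (hsn (p - A) * D)).
  by rewrite ler_wpM2l ?hsn_ge0// /D; have := ler_norm C; lra.
by rewrite -ltr_pdivlMr.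
Qed.

(** Operators and their adjoints converge together at every vector, the adjoint being isometric. The
    adjunction passes to the limit and makes the limit linear; a Fatou argument over finite parts of
    the basis controls its Hilbert-Schmidt norm. *)
Lemma hsop_complete (F : set_system hsop) : ProperFilter F -> cauchy F -> cvg F.
Proof.
move=> FF cF.
have exT : forall x, exists z : H, (fun A : hsop => A x) @ F --> z.
  move=> x; apply/cvg_ex; apply: (@cauchy_hsop_eval _ _ _ (hn x)) => // A B.
  exact: (hn_hsop (A - B)).
have [T FT] := @choice H H (fun x (z : H) => (fun A : hsop => A x) @ F --> z) exT.
have exS : forall x, exists z : H, (fun A : hsop => hsop_adj A x) @ F --> z.
  move=> x; apply/cvg_ex; apply: (@cauchy_hsop_eval _ _ _ (hn x)) => // A B.
  by rewrite -hsn_adj hsop_adjB; exact: (hn_hsop (hsop_adj A - hsop_adj B)).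
have [S FS] := @choice H H (fun x (z : H) => (fun A : hsop => hsop_adj A x) @ F --> z) exS.
have TS : adjoint_pair T S.
  move=> x y; apply/eqP; rewrite -subr_eq0; apply/eqP/abs2_small => d d0.
  pose K := 2 * sqn y + 2 * sqn x + 1.
  have K0 : 0 < K by rewrite ltr_wpDl// addr_ge0// mulr_ge0 ?sqn_ge0.
  have dK : 0 < Num.sqrt (d / K) by rewrite sqrtr_gt0 divr_gt0.
  have [A [TA SA]] : exists A, hn (T x - A x) < Num.sqrt (d / K) /\
      hn (S y - hsop_adj A y) < Num.sqrt (d / K).
    apply: (@filter_ex _ F); apply: filterI.
      exact: (iffLR (@cvg_hnP R H _ _ _ _ _) (FT x)).
    exact: (iffLR (@cvg_hnP R H _ _ _ _ _) (FS y)).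
  have -> : hdot (T x) y - hdot x (S y) =
      hdot (T x - A x) y + hdot x (hsop_adj A y - S y).
    by rewrite dotBl dotBr (hsop_pair A); ring.
  apply: le_trans (abs2D _ _) _.
  have h1 := cauchy_schwarz (T x - A x) y.
  have h2 := cauchy_schwarz x (hsop_adj A y - S y).
  have sq (z : H) : hn z < Num.sqrt (d / K) -> sqn z <= d / K.
    move=> zd; rewrite sqn_hn -[leRHS](sqr_sqrtr (ltW (divr_gt0 d0 K0))).
    by rewrite lerXn2r ?nnegrE ?hn_ge0 ?sqrtr_ge0// ltW.
  have {}TA := sq _ TA.
  have {}SA : sqn (hsop_adj A y - S y) <= d / K by rewrite -opprB sqnN; exact: sq.
  have h3 := ler_wpM2r (sqn_ge0 y) TA; have h4 := ler_wpM2l (sqn_ge0 x) SA.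
  have -> : d = (d / K) * K by rewrite divfK// gt_eqF.
  have : 0 < d / K by rewrite divr_gt0.
  rewrite /K; set q := d / K in h3 h4 *; lra.
have near_sum (r : seq H) (P : pred H) (d : R) : 0 < d ->
    \forall A \near F, \sum_(e <- r | P e) sqn (T e - (A : hsop) e) <= d.
  elim: r d => [|x r IH] d d0; first by near=> A; rewrite big_nil ltW.
  have d2 : 0 < d / 2 by rewrite divr_gt0.
  have sd2 : 0 < Num.sqrt (d / 2) by rewrite sqrtr_gt0.
  have xd : \forall A \near F, hn (T x - (A : hsop) x) < Num.sqrt (d / 2).
    exact: (iffLR (@cvg_hnP R H _ _ _ _ _) (FT x)).
  apply: filterS2 (IH _ d2) xd => A rA xA; rewrite big_cons.
  have : sqn (T x - A x) <= d / 2.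
    rewrite sqn_hn -[leRHS](sqr_sqrtr (ltW d2)).
    by rewrite lerXn2r ?nnegrE ?hn_ge0 ?sqrtr_ge0// ltW.
  by case: ifP => _; lra.
(* For each finite set [D] of vectors, choose [A] both in the ball around [p] and pointwise close to
   [T] on the basis vectors in [D]. Young's inequality with parameter 1 gives [2 * d ^+ 2] twice,
   independently of [D]. *)
have T_close (p : hsop) (d : R) : 0 < d -> F (ball p d) ->
    (hs2 (T - (p : H -> H))%R <= (4 * d ^+ 2)%:E)%E.
  move=> d0 Fp; apply/esum_leP => [e|D]; first exact: sqn_ge0.
  have dd : 0 < d ^+ 2 by rewrite exprn_gt0.
  have [A [pA sA]] := filter_ex (filterI Fp (near_sum D (mem (@onb R H)) _ dd)).
  move: pA; rewrite -ball_normE /= hsop_normE => /ltW; rewrite hsn_le ?(ltW d0)// => /hsq_le.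
  move=> /esum_leP => /(_ (fun e => sqn_ge0 _) D) pA.
  apply: (@le_trans _ _ (\sum_(e <- D | e \in @onb R H)
      ((1 + 1) * sqn (T e - A e) + (1 + 1^-1) * sqn ((p - A)%R e)))).
    apply: ler_sum => e _.
    have -> : (T - (p : H -> H)) e = (T e - A e) + - (p e - A e).
      by rewrite opprB addrA subrK.
    by have := sqnD_young (T e - A e) (- (p e - A e)) ltr01; rewrite sqnN.
  rewrite big_split /= -!mulr_sumr invr1.
  apply: (@le_trans _ _ (2 * d ^+ 2 + 2 * d ^+ 2)); last by lra.
  by rewrite lerD// ler_wpM2l.
have pT (p : hsop) : adjoint_pair (T - (p : H -> H)) (S - (hsop_adj p : H -> H)).
  move=> x y; rewrite -[LHS]/(hdot (T x - p x) y) -[RHS]/(hdot x (S y - hsop_adj p y)).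
  by rewrite dotBl dotBr TS (hsop_pair p).
have /cauchyP cF' := cF.
have [p0 Fp0] := cF' 1 ltr01.
have hsT : hilbert_schmidt T.
  rewrite -(subrK (p0 : H -> H) T); apply: hilbert_schmidtD; last exact: hsopP.
  apply/hilbert_schmidtP; split; first by exists (S - (hsop_adj p0 : H -> H)); exact: pT.
  by apply: le_lt_trans (T_close _ _ ltr01 Fp0) (ltry _).
apply/cvg_ex; exists (HSop hsT); apply/cvgrPdist_lt => e e0.
(* The limit is within [2 * (e / 4)] of [p], and [p] is within [e / 4] of [A], which totals less
   than [e]. *)
have e4 : 0 < e / 4 by rewrite divr_gt0.
have [p Fp] : exists p : hsop, F (ball p (e / 4)) := cF' _ e4.
apply: filterS (Fp) => A; rewrite -ball_normE /= => pA.
rewrite -(subrKA p); apply: le_lt_trans (ler_normD _ _) _.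
have : `|HSop hsT - p| <= 2 * (e / 4).
  have : hsq (HSop hsT - p) <= (2 * (e / 4)) ^+ 2.
    have -> : (2 * (e / 4)) ^+ 2 = 4 * (e / 4) ^+ 2 by ring.
    have e1 : hsfun (HSop hsT - p) = T - (p : H -> H) by apply/funext.
    have := T_close p _ e4 Fp; rewrite -e1 hsqE lee_fin; exact.
  by rewrite -hsn_le// mulr_ge0// ltW.
lra.
Unshelve. all: by end_near. Qed.

HB.instance Definition _ := Uniform_isComplete.Build hsop hsop_complete.

Lemma hsopMDl A B D : hsopM (A + B) D = hsopM A D + hsopM B D.
Proof. by apply: hsop_ext. Qed.

Lemma hsop_linear A : linear A.
Proof. exact: adjoint_pair_linear (hsop_pair A). Qed.

Lemma hsopMDr A B D : hsopM A (B + D) = hsopM A B + hsopM A D.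
Proof. by apply: hsop_ext => x; exact: (linear_opD _ _ (hsop_linear A)). Qed.

Lemma hsopMA A B D : hsopM A (hsopM B D) = hsopM (hsopM A B) D.
Proof. by apply: hsop_ext. Qed.

Lemma hsopMZl (k : R) A B : hsopM (k *: A) B = k *: hsopM A B.
Proof. by apply: hsop_ext. Qed.

Lemma hsopMZr (k : R) A B : hsopM A (k *: B) = k *: hsopM A B.
Proof. by apply: hsop_ext => x; exact: (linear_opZ _ _ (hsop_linear A)). Qed.

Lemma hsop_normM A B : `|hsopM A B| <= `|A| * `|B|.
Proof.
rewrite !hsop_normE hsn_le ?mulr_ge0 ?hsn_ge0// exprMn !hsn_sqr.
apply/hsq_le; apply: hs2_comp; rewrite ?hsqE ?hsq_ge0//.
by move=> x; exact: hsop_bound.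
Qed.

Lemma hsop_adjE A (S : H -> H) : adjoint_pair A S -> hsop_adj A =1 S.
Proof. by move=> AS x; rewrite /= (adjoint_pairE AS). Qed.

Lemma hsop_adjD A B : hsop_adj (A + B) = hsop_adj A + hsop_adj B.
Proof.
by apply: hsop_ext; apply: hsop_adjE; exact: adjoint_pairD (hsop_pair A) (hsop_pair B).
Qed.

Lemma hsop_adjZ (k : R) A : hsop_adj (k *: A) = k *: hsop_adj A.
Proof. by apply: hsop_ext; apply: hsop_adjE; exact: adjoint_pairZ (hsop_pair A). Qed.

Lemma hsop_adjM A B : hsop_adj (hsopM A B) = hsopM (hsop_adj B) (hsop_adj A).
Proof.
by apply: hsop_ext; apply: hsop_adjE; exact: adjoint_pair_comp (hsop_pair A) (hsop_pair B).
Qed.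

Lemma hsop_adjK A : hsop_adj (hsop_adj A) = A.
Proof. by apply: hsop_ext; apply: hsop_adjE; exact: adjoint_pairC (hsop_pair A). Qed.

HB.instance Definition _ := isBanachStar.Build R hsop hsopMDl hsopMDr hsopMA
  hsopMZl hsopMZr hsop_normM hsop_adjD hsop_adjZ hsop_adjM hsop_adjK hsn_adj.

End HilbertSchmidtCompleteness.

(** * The adjoint action on Hilbert-Schmidt operators *)

Section AdjointAction.
Variables (R : realType) (H : hilbertType R) (G : groupType) (pi : G -> H -> H).
Hypothesis hpi : unitary_rep pi.
Local Notation hsop := (@hsop R H).
Implicit Types (A B : hsop) (g h : G).

Lemma unitary_rep1 : pi 1%g = id.
Proof.
have [_ [f fK _] _] := hpi.1 1%g; apply/funext => x.
by apply: (can_inj fK); have := congr1 (fun f => f x) (hpi.2 1%g 1%g); rewrite mulg1.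
Qed.

Lemma unitary_repK g x : pi g (pi g^-1%g x) = x.
Proof. by rewrite -[LHS]/((pi g \o pi g^-1%g) x) -hpi.2 mulgV unitary_rep1. Qed.

Lemma unitary_repVK g x : pi g^-1%g (pi g x) = x.
Proof. by have := unitary_repK g^-1%g x; rewrite invgK. Qed.

Lemma unitary_rep_pair g : adjoint_pair (pi g) (pi g^-1%g).
Proof.
by move=> x y; have [_ _ iso] := hpi.1 g; rewrite -[y in LHS](unitary_repK g) iso.
Qed.

Lemma sqn_unitary_rep g x : sqn (pi g x) = sqn x.
Proof. by have [_ _ iso] := hpi.1 g; rewrite /sqn iso. Qed.

(** Right composition with a unitary would move the basis; passing to adjoints turns it into left
    composition with an isometry. *)
Lemma hs2_unitary_r T S g : adjoint_pair T S -> hs2 (T \o pi g) = hs2 T.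
Proof.
move=> TS; rewrite -(hs2_adjoint (adjoint_pair_comp TS (unitary_rep_pair g))).
rewrite hs2_isometry; last exact: sqn_unitary_rep.
exact: hs2_adjoint.
Qed.

Lemma hs2_Ad T S g : adjoint_pair T S -> hs2 (Ad pi g T) = hs2 T.
Proof.
move=> TS; rewrite /Ad (hs2_unitary_r _ (adjoint_pair_comp (unitary_rep_pair g) TS)).
by rewrite hs2_isometry//; exact: sqn_unitary_rep.
Qed.

Lemma Ad_pair T S g : adjoint_pair T S -> adjoint_pair (Ad pi g T) (Ad pi g S).
Proof.
move=> TS x y; rewrite /Ad /= (unitary_rep_pair g) TS.
by rewrite (adjoint_pairC (unitary_rep_pair g)).
Qed.

Lemma hilbert_schmidt_Ad T g : hilbert_schmidt T -> hilbert_schmidt (Ad pi g T).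
Proof.
move=> /hilbert_schmidtP[[S TS] Tf]; apply/hilbert_schmidtP.
by rewrite (hs2_Ad g TS); split=> //; exists (Ad pi g S); exact: Ad_pair.
Qed.

Definition hs_act g A : hsop := HSop (hilbert_schmidt_Ad g (hsopP A)).

Lemma unitary_rep_linear g : linear (pi g).
Proof. exact: adjoint_pair_linear (unitary_rep_pair g). Qed.

Lemma hs_act_action : star_action hs_act.
Proof.
split=> [g A B|g k A|g A B|g A|g A|g h A|A].
- by apply: hsop_ext => x; exact: (linear_opD _ _ (unitary_rep_linear g)).
- by apply: hsop_ext => x; exact: (linear_opZ _ _ (unitary_rep_linear g)).
- by apply: hsop_ext => x; rewrite /= /Ad /= unitary_repVK.
- apply: hsop_ext => x; apply/esym; move: x; apply: hsop_adjE.
  exact: Ad_pair (hsop_pair A).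
- by rewrite !hsop_normE /hsn /hsq (hs2_Ad g (hsop_pair A)).
- apply: hsop_ext => x; rewrite /= /Ad /= invgM.
  by rewrite !(hpi.2 _ _).
- by apply: hsop_ext => x; rewrite /= /Ad /= invg1 unitary_rep1.
Qed.

End AdjointAction.

(** * Evaluation of the formal deformation *)

Section Evaluation.
Variables (R : realType) (V : banachStarType R) (n : nat).
Implicit Types (u v : seq 'I_n -> V) (w : seq 'I_n) (t : 'I_n -> R).

(** A [limn], hence meaningful only under a uniform bound on [wnorm] at a radius that dominates
    [t]. *)
Definition eval t u : V := limn (fun k => weval t k u).

Section Radius.
Variables (t : 'I_n -> R) (r : R).
Hypothesis tr : forall x, `|t x| <= r.
Hypothesis r0 : 0 <= r.

Lemma eval_cvg u M : (forall k, wnorm r k u <= M) ->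
  weval t k u @[k --> \oo] --> eval t u.
Proof. exact: weval_cvg. Qed.

Lemma eval_circ u v M N : (forall k, wnorm r k u <= M) -> (forall k, wnorm r k v <= N) ->
  eval t (circ u v) = eval t u + eval t v + smul (eval t u) (eval t v).
Proof.
move=> uM vN; have uvMN k : wnorm r k (conv u v) <= M * N.
  by apply: le_trans (wnorm_conv r0 k u v) _; rewrite ler_pM ?wnorm_ge0.
rewrite -(weval_conv tr r0 uM vN); apply/cvg_lim => //.
under eq_fun do rewrite /circ !wevalD.
by apply: cvgD; [apply: cvgD; [exact: eval_cvg uM|exact: eval_cvg vN]|exact: eval_cvg uvMN].
Qed.

Lemma eval_sstar u M : (forall k, wnorm r k u <= M) ->
  eval t (sstar u) = sadj (eval t u).
Proof.
move=> uM; apply/cvg_lim => //; under eq_fun do rewrite weval_sstar.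
exact: cvg_sadj (eval_cvg uM).
Qed.

Lemma eval_sact (G : groupType) (act : G -> V -> V) (hact : star_action act) g u M :
  (forall k, wnorm r k u <= M) -> eval t (sact act g u) = act g (eval t u).
Proof.
move=> uM; apply/cvg_lim => //.
rewrite (_ : (fun k => _) = (fun k => act g (weval t k u))).
  by apply: (cvg_act hact); exact: eval_cvg uM.
apply/funext => k; rewrite /weval (act_sum hact).
by apply: eq_bigr => w _; rewrite -(actZ hact).
Qed.

End Radius.

Lemma eval0 t : eval t (0 : seq 'I_n -> V) = 0.
Proof.
apply/cvg_lim => //; rewrite (_ : (fun k => _) = cst 0); first exact: cvg_cst.
by apply/funext => k; rewrite /weval big1// => w _; rewrite scaler0.
Qed.

(** Only words of length at least 2 contribute to the remainder, and each of them gains the factor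
    [(s / r) ^+ 2] when the radius shrinks from [r] to [s]. *)
Lemma eval_linear_part t (r s M : R) u : (forall x, `|t x| <= s) -> 0 <= s <= r -> 0 < r ->
  u [::] = 0 -> (forall k, wnorm r k u <= M) ->
  `|eval t u - \sum_x t x *: u [:: x]| <= (s / r) ^+ 2 * M.
Proof.
move=> ts /andP[s0 sr] r0 u0 uM.
have uM' k : wnorm s k u <= M.
  apply: le_trans (uM k); apply: ler_sum => w _.
  by rewrite ler_wpM2r// lerXn2r// nnegrE// ltW.
have -> : \sum_x t x *: u [:: x] = weval t 1 u.
  rewrite wevalS u0 add0r; apply: eq_bigr => x _.
  by rewrite /weval big_seq1 /wmono big_nil scale1r.
have cu : (weval t k u - weval t 1 u) @[k --> \oo] --> eval t u - weval t 1 u.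
  by apply: cvgB; [exact: (eval_cvg ts s0 uM')|exact: cvg_cst].
rewrite -(cvg_lim _ (cvg_norm cu))//; apply: limr_le; first exact: cvgP (cvg_norm cu).
near=> k; have k1 : (1 <= k)%N by near: k; exact: nbhs_infty_ge.
apply: le_trans (weval_increment ts u k1) _.
rewrite -wnorm_subtrunc// /wnorm.
apply: (@le_trans _ _ (\sum_(w <- words 'I_n k) (s / r) ^+ 2 * (r ^+ size w * `|u w|))).
  apply: ler_sum => w _; rewrite !fctE /trunc mulrA.
  have rhs0 : 0 <= (s / r) ^+ 2 * r ^+ size w by rewrite mulr_ge0 ?exprn_ge0 ?divr_ge0 ?(ltW r0).
  case: ifP => [_|]; first by rewrite subrr normr0 mulr0 mulr_ge0.
  move=> /negbT; rewrite -ltnNge => w1; rewrite subr0 ler_wpM2r//.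
  rewrite -(subnKC w1) !exprD mulrA -exprMn divfK ?gt_eqF//.
  by rewrite ler_wpM2l ?exprn_ge0// lerXn2r ?nnegrE ?s0 ?(ltW r0).
rewrite -mulr_sumr ler_wpM2l ?sqr_ge0//; exact: uM.
Unshelve. all: by end_near. Qed.

(** The exponent of the monomial that [w] becomes once the letters commute. *)
Definition content w : {ffun 'I_n -> nat} := [ffun i => count_mem i w].

Lemma multidegree_content w : multidegree (content w) = size w.
Proof.
rewrite /multidegree; under eq_bigr do rewrite ffunE.
elim: w => [|x w IH] /=; first by rewrite big1.
rewrite big_split /= IH (bigD1 x)//= eqxx big1 ?addn0// => i ix.
by rewrite eq_sym (negbTE ix).
Qed.

Lemma monomial_content (t : 'rV[R]_n) w :
  monomial t (content w) = wmono (t ord0) w.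
Proof.
rewrite /monomial /wmono; under eq_bigr do rewrite ffunE.
elim: w => [|x w IH] /=; first by rewrite big_nil big1.
rewrite big_cons -IH; under eq_bigr do rewrite exprD.
rewrite big_split /=; congr (_ * _).
rewrite (bigD1 x)//= eqxx big1 ?mulr1// => i ix.
by rewrite eq_sym (negbTE ix).
Qed.

(** All words with content [a] have length [multidegree a], so the finite list contains every one of
    them. *)
Definition coeff u (a : {ffun 'I_n -> nat}) : V :=
  \sum_(w <- words 'I_n (multidegree a) | content w == a) u w.

Lemma big_content (T : nmodType) (f : seq 'I_n -> T) a k : (multidegree a <= k)%N ->
  \sum_(w <- words 'I_n (multidegree a) | content w == a) f w =
  \sum_(w <- words 'I_n k | content w == a) f w.
Proof.
move=> ak; rewrite -(perm_big _ (perm_words 'I_n ak)) big_filter_cond.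
apply: eq_bigl => w; apply: andb_idl => /eqP <-.
by rewrite multidegree_content.
Qed.

Lemma sum_content (T : nmodType) (f : seq 'I_n -> T) (A : seq {ffun 'I_n -> nat}) k :
  uniq A ->
  \sum_(a <- A) \sum_(w <- words 'I_n k | content w == a) f w =
  \sum_(w <- words 'I_n k | content w \in A) f w.
Proof.
move=> uA; rewrite big_seq (exchange_big_dep (fun w => content w \in A)) /=; last first.
  by move=> a w aA /eqP ->.
apply: eq_bigr => w wA; rewrite big_mkcond (bigD1_seq (content w))//= wA eqxx.
by rewrite big1 ?addr0// => a aw; rewrite eq_sym (negbTE aw) andbF.
Qed.

Lemma coeff_norm_sum (t : 'rV[R]_n) (r M : R) u (A : {fset {ffun 'I_n -> nat}}) :
  (forall x, `|t ord0 x| <= r) -> 0 <= r -> (forall k, wnorm r k u <= M) ->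
  \sum_(a <- A) `|monomial t a| * `|coeff u a| <= M.
Proof.
move=> tr r0 uM; pose K := \max_(a <- A) multidegree a.
have aK a : a \in A -> (multidegree a <= K)%N by move=> aA; exact: leq_bigmax_seq.
apply: le_trans (uM K).
apply: (@le_trans _ _ (\sum_(a <- A) \sum_(w <- words 'I_n K | content w == a)
    r ^+ size w * `|u w|)).
  rewrite big_seq [leRHS]big_seq; apply: ler_sum => a aA.
  rewrite /coeff (big_content _ (aK a aA)).
  apply: le_trans (ler_wpM2l (normr_ge0 _) (ler_norm_sum _ _ _)) _.
  rewrite mulr_sumr; apply: ler_sum => w /eqP <-.
  by rewrite monomial_content ler_wpM2r// ler_wmono.
rewrite sum_content ?fset_uniq// /wnorm [leRHS](bigID (fun w => content w \in A)) /=.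
by rewrite lerDl; apply: sumr_ge0 => w _; rewrite mulr_ge0// exprn_ge0.
Qed.

Lemma coeff_sum_close (t : 'rV[R]_n) (r M : R) u k0 (A : {fset {ffun 'I_n -> nat}}) :
  (forall x, `|t ord0 x| <= r) -> 0 <= r -> (forall k, wnorm r k u <= M) ->
  (forall w, (size w <= k0)%N -> content w \in A) ->
  `|eval (t ord0) u - \sum_(a <- A) monomial t a *: coeff u a| <=
  limn (fun k => wnorm r k u) - wnorm r k0 u.
Proof.
(* [K] dominates [k0] and all degrees in [A], so the sum over [A] is a subsum of [weval] at length
   [K]. The words it omits are longer than [k0]. *)
move=> tr r0 uM k0A; pose K := maxn k0 (\max_(a <- A) multidegree a).
have aK a : a \in A -> (multidegree a <= K)%N.
  by move=> aA; rewrite leq_max (leq_bigmax_seq _ aA) ?orbT.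
have -> : \sum_(a <- A) monomial t a *: coeff u a =
    \sum_(w <- words 'I_n K | content w \in A) wmono (t ord0) w *: u w.
  rewrite -sum_content ?fset_uniq// big_seq [RHS]big_seq; apply: eq_bigr => a aA.
  rewrite /coeff (big_content _ (aK a aA)) scaler_sumr; apply: eq_bigr => w /eqP <-.
  by rewrite monomial_content.
have h1 := weval_tail tr r0 K uM.
rewrite -(subrKA (weval (t ord0) K u)); apply: le_trans (ler_normD _ _) _.
have : `|weval (t ord0) K u - \sum_(w <- words 'I_n K | content w \in A)
    wmono (t ord0) w *: u w| <= wnorm r K u - wnorm r k0 u.
  rewrite /weval (bigID (fun w => content w \in A)) /= addrC addrK.
  apply: le_trans (ler_norm_sum _ _ _) _.
  rewrite -wnorm_subtrunc ?leq_maxl// /wnorm big_mkcond; apply: ler_sum => w _.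
  case: ifP => [wA|_]; last by rewrite mulr_ge0// exprn_ge0.
  rewrite !fctE /trunc; case: ifP => [wk|_]; first by rewrite k0A in wA.
  by rewrite subr0 normrZ ler_wpM2r// ler_wmono.
rewrite -/(eval _ _) in h1; lra.
Qed.

End Evaluation.

(** * Transfer of cochains and assembly of the deformation *)

Section FromCochains.
Variables (R : realType) (H : hilbertType R) (G : groupType) (pi : G -> H -> H).
Hypothesis hpi : unitary_rep pi.
Local Notation hsop := (@hsop R H).

Lemma cocycle1_hsop (c : 1.-tuple G -> H -> H) (hsc : forall t, hilbert_schmidt (c t)) g h :
  cobound (Ad pi) c = 0 ->
  HSop (hsc [tuple (g * h)%g]) = HSop (hsc [tuple g]) + hs_act hpi g (HSop (hsc [tuple h])).
Proof.
move=> dc0; apply: hsop_ext => x.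
have := congr1 (fun f => f [tuple g; h] x) dc0; rewrite cobound1E.
rewrite -[LHS]/(Ad pi g (c [tuple h]) x - c [tuple (g * h)%g] x + c [tuple g] x).
rewrite -[RHS]/(0 : H) => /eqP; rewrite addrAC subr_eq0 => /eqP e.
by rewrite -[LHS]/(c [tuple (g * h)%g] x) -e addrC.
Qed.

Lemma cohomology2_hsop :
  cohomology_vanishes (@hilbert_schmidt R H) (Ad pi) 2 ->
  forall z : G * G -> hsop, cocycle2 (hs_act hpi) z -> exists b, d1 (hs_act hpi) b = z.
Proof.
move=> hH2 z cz.
pose z2 (t : 2.-tuple G) : H -> H := z (tnth t ord0, tnth t ord_max).
have : coboundary (@hilbert_schmidt R H) (Ad pi) (k := 2) z2.
  apply: hH2; split; first by move=> t; exact: hsopP.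
  apply/funext => t; apply/funext => x.
  case/tupleP: t => g t; case/tupleP: t => h t; case/tupleP: t => k t.
  have -> : [tuple of g :: [tuple of h :: [tuple of k :: t]]] = [tuple g; h; k].
    by apply: val_inj; rewrite /= (tuple0 t).
  rewrite cobound2E; have := congr1 (fun A : hsop => A x) (cz g h k).
  by rewrite /z2 !(tnth_nth g).
case=> b hb db; exists (fun g => HSop (hb [tuple g])); apply/funext => -[g h].
apply: hsop_ext => x; have := congr1 (fun f => f [tuple g; h] x) db.
by rewrite cobound1E /z2 !(tnth_nth g).
Qed.

Lemma hsop_sumE (I : Type) (r : seq I) (P : pred I) (F : I -> hsop) :
  hsfun (\sum_(i <- r | P i) F i) = \sum_(i <- r | P i) hsfun (F i).
Proof. by apply: (big_morph (@hsfun R H)). Qed.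

(* [1 + E g] is unitary in the unitization, so [(1 + E g) \pi(g)] is a unitary
   representation; invertibility comes from the relation in G. *)
Lemma unitary_rep_perturb (E : G -> hsop) : E 1%g = 0 ->
  (forall g h, E (g * h)%g = E g + hs_act hpi g (E h) + hsopM (E g) (hs_act hpi g (E h))) ->
  (forall g, E g + hsop_adj (E g) + hsopM (E g) (hsop_adj (E g)) = 0) ->
  unitary_rep (fun g => (id + hsfun (E g)) \o pi g).
Proof.
move=> E1 EM EU; pose P g x := pi g x + E g (pi g x).
have PM g h x : P (g * h)%g x = P g (P h x).
  rewrite /P EM (hpi.2 g h) /= (linear_opD _ _ (unitary_rep_linear hpi g)).
  set y := pi g (pi h x).
  have -> : pi g (E h (pi h x)) = hs_act hpi g (E h) y.
    by rewrite /= /Ad /= unitary_repVK.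
  rewrite (linear_opD _ _ (hsop_linear (E g))).
  rewrite -[LHS]/(y + (E g y + hs_act hpi g (E h) y + E g (hs_act hpi g (E h) y))).
  by rewrite !addrA [X in X + _ = _]addrAC.
have P1 x : P 1%g x = x by rewrite /P E1 unitary_rep1// -[(0 : hsop) x]/(0 : H) addr0.
have PK g : cancel (P g) (P g^-1%g) by move=> x; rewrite -PM mulVg P1.
have PVK g : cancel (P g^-1%g) (P g) by move=> x; rewrite -PM mulgV P1.
have Ppair g : adjoint_pair (P g) (fun y => pi g^-1%g (y + hsop_adj (E g) y)).
  move=> x y; rewrite /P -(unitary_rep_pair hpi) dotDl dotDr.
  by rewrite (hsop_pair (E g)).
have PQ g y : P g (pi g^-1%g (y + hsop_adj (E g) y)) = y.
  rewrite /P unitary_repK// (linear_opD _ _ (hsop_linear (E g))).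
  have := congr1 (fun A : hsop => A y) (EU g).
  rewrite -[LHS]/(E g y + hsop_adj (E g) y + E g (hsop_adj (E g) y)) -[RHS]/(0 : H) => e.
  by rewrite -addrA [hsop_adj (E g) y + _]addrA [hsop_adj (E g) y + _]addrC e addr0.
split=> [g|g h]; last by apply/funext => x; exact: PM.
split; first exact: adjoint_pair_linear (Ppair g).
  exact: Bijective (PK g) (PVK g).
(* The adjoint is a right inverse of [P g] by unitarity, and [P g] is injective, so it is also a
   left inverse; this gives preservation of [hdot]. *)
move=> x y; rewrite -[LHS]/(hdot (P g x) (P g y)) (Ppair g).
by congr (hdot _ _); apply: (can_inj (PK g)); rewrite PQ.
Qed.

End FromCochains.

Lemma hs_power_series_eval (R : realType) (H : hilbertType R) (n : nat)
    (u : seq 'I_n -> @hsop R H) (t : 'rV[R]_n) (r M : R) :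
  (forall x, `|t ord0 x| <= r) -> 0 <= r -> u [::] = 0 ->
  (forall k, wnorm r k u <= M) ->
  hs_power_series (fun a => hsfun (coeff u a)) t (id + hsfun (eval (t ord0) u)).
Proof.
move=> tr r0 u0 uM; set E := eval _ _.
have idE : id + hsfun E - id = hsfun E by rewrite addrC addKr.
have coeff0 a : (multidegree a < 1)%N -> coeff u a = 0.
  rewrite ltnS leqn0 => /eqP a0; rewrite /coeff a0 big_seq_cond big1// => w.
  by rewrite mem_words leqn0 size_eq0 => /andP[/eqP ->].
split; first by rewrite idE; exact: hsopP.
split.
  apply: (@le_lt_trans _ _ M%:E); last exact: ltry.
  rewrite (eq_esum (b := fun a => (`|monomial t a| * `|coeff u a|)%:E)); last first.
    by move=> a _; rewrite hs_norm_hsop EFinM.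
  apply/esum_leP => [a|A]; first by rewrite mulr_ge0.
  apply: le_trans (coeff_norm_sum A tr r0 uM).
  by rewrite big_mkcond; apply: ler_sum => a _; case: ifP => // _; rewrite mulr_ge0.
rewrite (_ : (fun A : {fset _} => _) = (fun A : {fset {ffun 'I_n -> nat}} =>
    (`|E - \sum_(a <- A) monomial t a *: coeff u a|)%:E)); last first.
  apply/funext => A; rewrite idE.
  have -> : \sum_(a <- A) monomial t a *: coeff u a =
      \sum_(a <- A | (1 <= multidegree a)%N) monomial t a *: coeff u a.
    rewrite [RHS]big_mkcond; apply: eq_bigr => a _; case: ifP => // /negbT.
    by rewrite -ltnNge => /coeff0 ->; rewrite scaler0.
  rewrite hsop_normE -hs_norm_hsop; congr hs_norm.
  by rewrite -[RHS]/(hsfun E - hsfun (\sum_(a <- A | _) _)) hsop_sumE.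
apply: cvg_EFin; first by near=> A.
apply/cvgrPdist_lt => e e0.
have wc := wnorm_cvg r0 uM.
have [k0 k0e] : exists k, limn (fun k => wnorm r k u) - wnorm r k u < e.
  have /cvgrPdist_lt/(_ e e0)/filter_ex[k ke] := wc.
  by exists k; apply: le_lt_trans ke; exact: ler_norm.
(* Once a finite set of multi-indices contains the contents of all words of length at most [k0], the
   error involves longer words only. *)
exists [fset content w | w in words 'I_n k0]%fset => // A /= k0A.
rewrite sub0r normrN normr_id; apply: le_lt_trans k0e.
apply: (coeff_sum_close tr r0 uM) => w wk; apply: (fsubsetP k0A).
by apply/imfsetP; exists w => //=; rewrite mem_words.
Unshelve. all: by end_near. Qed.

Theorem theoremA (R : realType) (H : hilbertType R) (G : groupType)
    (pi : G -> H -> H) (n : nat) (c : 'I_n -> 1.-tuple G -> H -> H)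
    (hG : finitely_generated G) (hH : separable_space H)
    (hpi : unitary_rep pi) (hn : (1 <= n)%N)
    (hc : forall i, cocycle (@hilbert_schmidt R H) (Ad pi) (c i))
    (hskew : forall i g, skew_adjoint (c i g))
    (hH2 : cohomology_vanishes (@hilbert_schmidt R H) (Ad pi) 2) :
  exists (U : set 'rV[R]_n) (pit : 'rV[R]_n -> G -> H -> H),
    analytic_unitary_deformation pi U pit /\
    forall (i : 'I_n) (g : G),
      hs_partial_at0 (pit ^~ g) i (c i [tuple g] \o pi g).
Proof.
case: hG => s hs; have hact := hs_act_action hpi.
have hsc i t : hilbert_schmidt (c i t) := (hc i).1 t.
pose c1 i g : hsop H := HSop (hsc i [tuple g]).
have c1_cocycle i g h : c1 i (g * h)%g = c1 i g + hs_act hpi g (c1 i h).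
  exact: cocycle1_hsop (hc i).2.
have c1_skew i g : sadj (c1 i g) = - c1 i g.
  by apply: hsop_ext => x; rewrite /= (hskew i [tuple g]).
have [U [r [dU mU uU r0 bU]]] :=
  analytic_deformation hact hs (@cohomology2_hsop R H G pi hpi hH2) c1_cocycle c1_skew.
have U0 g : U g [::] = 0 := dU.1 g.
pose E (t : 'rV[R]_n) g : hsop H := eval (t ord0) (U g).
(* A polydisc: on it the monomial of any word is dominated by the weight in [wnorm r], for every [g]
   at once. *)
pose D := [set t : 'rV[R]_n | forall x, `|t ord0 x| < r].
have E1 t : E t 1%g = 0 by rewrite /E (deformation1 hact dU mU) eval0.
have Er t : D t -> unitary_rep (fun g => (id + hsfun (E t g)) \o pi g).
  move=> Dt; have tr x : `|t ord0 x| <= r by exact: ltW.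
  have [M hM] := choice bU.
  apply: unitary_rep_perturb => // [g h|g].
    rewrite /E mU (eval_circ tr (ltW r0) (hM g) (N := M h)); last first.
      by move=> k; rewrite (wnorm_sact hact).
    by rewrite (eval_sact tr (ltW r0) hact g (hM h)).
  rewrite -[hsop_adj _](eval_sstar tr (ltW r0) (hM g)).
  rewrite -(eval_circ tr (ltW r0) (hM g) (N := M g)) ?uU ?eval0// => k.
  by rewrite wnorm_sstar.
exists D, (fun t g => (id + hsfun (E t g)) \o pi g); split.
  split.
    rewrite openE => t Dt; rewrite /interior.
    apply: (@filter_forall _ _ (fun x u => `|u ord0 x| < r) (nbhs t)) => x.
    exact: cvgr_norm_lt (@coord_continuous _ _ _ ord0 x t) _ (Dt x).
  split; first by move=> x; rewrite mxE normr0.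
  split=> //.
  exists (fun t g => id + hsfun (E t g)), (fun a g => hsfun (coeff (U g) a)).
  split=> [a g _|t g Dt]; first exact: hsopP.
  have [M hM] := bU g; split=> //.
  by apply: (hs_power_series_eval (r := r) (M := M)) => // [x|]; exact: ltW.
move=> i g; have [M hM] := bU g.
pose F s : hsop H := s^-1 *: E (s *: 'e_i) g - c1 i g.
(* At the origin the remainder estimate applies with [s = 0], and its right-hand side vanishes. *)
have E0 : E 0 g = 0.
  apply/eqP; rewrite -normr_le0.
  have := @eval_linear_part _ _ _ ((0 : 'rV[R]_n) ord0) r 0 M (U g) _ _ r0 (U0 g) hM.
  rewrite big1 => [|x _]; last by rewrite mxE scale0r.
  rewrite subr0 mul0r expr0n mul0r; apply; last by rewrite lexx ltW.
  by move=> x; rewrite mxE normr0.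
(* The error of the difference quotient is [F] composed on the right with the unitary [pi g], which
   preserves the Hilbert-Schmidt norm, so the limit can be taken in [hsop]. *)
rewrite /hs_partial_at0 (_ : (fun s : R => _) = (fun s => (hsn (F s))%:E)); last first.
  apply/funext => a; have FP := hsop_pair (F a).
  have -> : (a^-1)%:C%C *: ((id + hsfun (E (a *: 'e_i) g)) \o pi g
        - ((id + hsfun (E 0 g)) \o pi g)) - (c i [tuple g] \o pi g) = hsfun (F a) \o pi g.
    apply/funext => x; rewrite E0; congr (_ - _).
    by rewrite -[RHS]/((a^-1)%:C%C *: _) !fctE addr0 addrC addKr.
  rewrite (hs_normE (adjoint_pair_comp FP (unitary_rep_pair hpi g))).
  by rewrite (hs2_unitary_r hpi _ FP) -(hs_normE FP) hs_norm_hsop.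
apply: cvg_EFin; first by near=> x.
(* The majorant is the quadratic remainder with [s = |a|], divided by [|a|]. *)
apply: (@squeeze_cvgr _ _ _ _ (fun=> 0) (fun a => `|a| * (M / r ^+ 2))).
- near=> a; have a0 : a != 0 by near: a; exact: nbhs_dnbhs_neq.
  have ar : `|a| <= r by near: a; exact: dnbhs0_le.
  rewrite hsn_ge0 /=.
  have -> : F a = a^-1 *: (E (a *: 'e_i) g - a *: c1 i g).
    by rewrite scalerBr scalerA mulVf// scale1r.
  rewrite hsnZ normfV ler_pdivrMl ?normr_gt0//.
  have -> : a *: c1 i g = \sum_x (a *: 'e_i : 'rV[R]_n) ord0 x *: U g [:: x].
    rewrite (bigD1 i)//= big1 => [|x xi]; last by rewrite !mxE (negbTE xi) andbF mulr0 scale0r.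
    by rewrite !mxE !eqxx mulr1 addr0 dU.2.
  rewrite (_ : `|a| * (`|a| * _) = (`|a| / r) ^+ 2 * M); last first.
    rewrite expr_div_n; field; exact: lt0r_neq0.
  rewrite -hsop_normE.
  apply: (@eval_linear_part _ _ _ ((a *: 'e_i : 'rV[R]_n) ord0)) => // [x|]; last first.
    by rewrite normr_ge0.
  by rewrite !mxE normrM ler_piMr//; case: (_ && _); rewrite ?normr1 ?normr0.
- exact: cvg_cst.
- rewrite -[X in _ --> X](mul0r (M / r ^+ 2)); apply: cvgMr_tmp.
  by rewrite -[X in _ --> X](normr0 R); apply: cvg_norm; exact: nbhs_dnbhs.
Unshelve. all: by end_near. Qed.
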